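(* Assume $u_0(\boldsymbol{x})\ge 0$ and $g(\boldsymbol{x},t)\ge 0$ for all $\boldsymbol{x}$ and $t$. Let $(\boldsymbol{u}^n)_{n\ge 0}$ be generated by the (linearized) implicit scheme $$(M-\Delta t_n B+\Delta t_n A)\,\boldsymbol{u}^{n+1} = (M+\Delta t_n\, C)\,\boldsymbol{u}^{n}+\Delta t_n\,\boldsymbol{g}^{n+1},\qquad n=0,1,\ldots,$$ where $B=(b_{ij})$ and $C=(c_{ij})$ are the $N_v\times N_v$ matrices (depending on $n$) with $$b_{ij}=\int_\Omega\left(f(u_h^n)+u_h^n f'(u_h^n)\right)\phi_j\phi_i\,d\boldsymbol{x},\qquad c_{ij}=-\int_\Omega u_h^n f'(u_h^n)\,\phi_j\phi_i\,d\boldsymbol{x}$$ for $i=1,\ldots,N_{vi}$, and $b_{ij}=c_{ij}=0$ for $i=N_{vi}+1,\ldots,N_v$ ($j=1,\ldots,N_v$). Suppose that for all $n=0,1,\ldots$ the mesh satisfies $$\mathbb{D}_{acute}>\left(\frac{|\Omega|}{N_e}\right)^{2/d}\frac{\max_{\boldsymbol{x}}\left|\left(f(u_h^n)+u_h^n f'(u_h^n)\right)^{-}\right|}{(d+1)(d+2)}$$ and the time step satisfies $$\frac{\left(\frac{|\Omega|}{N_e}\right)^{2/d}}{(d+1)(d+2)\,\mathbb{D}_{acute}-\left(\frac{|\Omega|}{N_e}\right)^{2/d}\max_{\boldsymbol{x}}\left|\left(f(u_h^n)+u_h^n f'(u_h^n)\right)^{-}\right|}\ \le\ \Delta t_n\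 <\ \frac{1}{\max_{\boldsymbol{x}}\left\{\left(u_h^n f'(u_h^n)\right)^{+},\ \left(f(u_h^n)+u_h^n f'(u_h^n)\right)^{+}\right\}}.$$ Then the scheme preserves nonnegativity: $u_j^n\ge 0$ for all $j=1,\ldots,N_v$ and all $n\ge 0$ (equivalently, $u_h^n\ge 0$ on $\Omega$ for all $n\ge 0$).
   Context: Continuous problem: $\partial_t u-\nabla\cdot(\mathbb{D}\nabla u)=u f(u)$ in $\Omega\times(0,T]$, $u=g$ on $\partial\Omega\times(0,T]$, $u(\cdot,0)=u_0$ in $\Omega$. Here $d\in\{1,2,3\}$, $\Omega\subset\mathbb{R}^d$ is a connected bounded polygonal or polyhedral domain, $T>0$; the diffusion tensor $\mathbb{D}=\mathbb{D}(\boldsymbol{x})$ is a $d\times d$ matrix function that is continuous (and integrable over $\Omega$), symmetric and uniformly positive definite on $\Omega$; $f:\mathbb{R}\to\mathbb{R}$ is such that $f$ and $f'$ exist, are continuous, and are bounded for all bounded $u$; $u_0$ and $g$ are given functions (with $u_0$ defined at all mesh vertices). Mesh: $\mathcal{T}_h$ is a (conforming) simplicial triangulation of $\Omega$ with $N_e$ elements, $N_v$ vertices $\boldsymbol{x}_1,\ldots,\boldsymbol{x}_{N_v}$, of which the first $N_{vi}$ are the interior vertices (not on $\partial\Omega$). $\phi_j$ is the continuous piecewise linear basis function with $\phi_j(\boldsymbol{x}_i)=\delta_{ij}$. $|K|$ and $|\Omega|$ denote volumes; $\mathbb{D}_K$ is the average of $\mathbb{D}$ over $K\in\mathcal{T}_h$.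 Matrices: $M=(m_{ij})$ with $m_{ij}=\int_\Omega\phi_j\phi_i\,d\boldsymbol{x}$ for $i\le N_{vi}$ and $m_{ij}=0$ for $i>N_{vi}$; $A=(a_{ij})$ with $a_{ij}=\int_\Omega(\nabla\phi_i)^T\mathbb{D}\nabla\phi_j\,d\boldsymbol{x}=\sum_{K\in\mathcal{T}_h}|K|(\nabla\phi_i)^T\mathbb{D}_K\nabla\phi_j$ (gradients taken on $K$) for $i\le N_{vi}$ and $a_{ij}=\delta_{ij}$ for $i>N_{vi}$ ($j=1,\ldots,N_v$). Time levels: $0=t_0<t_1<\cdots$ in $[0,T]$, $\Delta t_n=t_{n+1}-t_n$. The vector $\boldsymbol{u}^n=(u_1^n,\ldots,u_{N_v}^n)^T$ contains the nodal values of $u_h^n=\sum_{j=1}^{N_v}u_j^n\phi_j$, with initial vector $u_j^0=u_0(\boldsymbol{x}_j)$. $\boldsymbol{g}^{n+1}$ has entries $0$ for $i\le N_{vi}$ and $g(\boldsymbol{x}_i,t_{n+1})$ for $i>N_{vi}$. Mesh quantity: for each $K\in\mathcal{T}_h$ let $\phi_0,\ldots,\phi_d$ denote (local numbering) the linear basis functions on $K$ of its $d+1$ vertices, and set $$\mathbb{D}_{acute}=\left(\frac{|\Omega|}{N_e}\right)^{2/d}\min_{K\in\mathcal{T}_h}\ \min_{i,j=0,\ldots,d,\ i\ne j}\left(-(\nabla\phi_i)^T\mathbb{D}_K\nabla\phi_j\right).$$ Notation: $v^+=\max\{v,0\}$, $v^-=\min\{v,0\}$; $\max_{\boldsymbol{x}}$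 is the maximum over $\overline{\Omega}$, and $\max_{\boldsymbol{x}}\{p,q\}$ is the maximum over $\overline{\Omega}$ of the larger of $p$ and $q$. A fraction with positive numerator and zero denominator is read as $+\infty$. *)

(* Defs.v *)
From HB Require Import structures.
From mathcomp Require Import all_boot all_order all_algebra.
From mathcomp Require Import all_classical all_reals all_analysis.

Set Implicit Arguments.
Unset Strict Implicit.
Unset Printing Implicit Defensive.

Import Order.TTheory GRing.Theory Num.Theory.
Import numFieldNormedType.Exports.

Local Open Scope classical_set_scope.
Local Open Scope ring_scope.

(* The sigma-algebra on R^d = 'rV[R]_d is the one generated by the coordinates,
   that is, the Borel sigma-algebra. *)
Definition rV_display : measure_display -> measure_display.
Proof. exact. Qed.

Section measurable_rV.
Context {R : realType}.
Variable d : nat.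

Let coord : 'I_d -> 'rV[R]_d -> measurableTypeR R := fun i x => x ord0 i.

Let rV_set0 : g_sigma_preimage coord set0.
Proof. exact: sigma_algebra0. Qed.

Let rV_setC A : g_sigma_preimage coord A -> g_sigma_preimage coord (~` A).
Proof. exact: sigma_algebraC. Qed.

Let rV_bigcup (F : _^nat) : (forall i, g_sigma_preimage coord (F i)) ->
  g_sigma_preimage coord (\bigcup_i (F i)).
Proof. exact: sigma_algebra_bigcup. Qed.

HB.instance Definition _ :=
  @isMeasurable.Build (rV_display default_measure_display)
    'rV[R]_d (g_sigma_preimage coord) rV_set0 rV_setC rV_bigcup.

End measurable_rV.

Lemma measurable_coord {R : realType} (d : nat) (i : 'I_d) :
  measurable_fun [set: 'rV[R]_d] (fun x => x ord0 i : measurableTypeR R).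
Proof.
move=> _ Y mY; rewrite setTI; apply: sub_sigma_algebra => /=.
rewrite -bigcup_seq/=; exists i => /=; first by rewrite mem_index_enum.
by exists Y => //; rewrite setTI.
Qed.

Lemma measurable_fun_rV {R : realType} (disp : measure_display)
    (T : measurableType disp) (d : nat) (f : T -> 'rV[R]_d) :
  (forall i, measurable_fun setT (fun t => f t ord0 i : measurableTypeR R)) ->
  measurable_fun setT f.
Proof.
move=> mf; apply: (@measurability _ _ _ _ setT f _ erefl).
move=> _ [B /=] + <-; rewrite -bigcup_seq => -[i _ [A mA <-]].
by rewrite !setTI; have := mf i measurableT _ mA; rewrite setTI.
Qed.

Section lebesgue_rV_step.
Context {R : realType}.
Variable d : nat.

Definition rV_cons (p : measurableTypeR R * 'rV[R]_d) : 'rV[R]_d.+1 :=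
  @row_mx R 1 1 d (p.1 : R)%:M p.2.

Definition rV_uncons (x : 'rV[R]_d.+1) : measurableTypeR R * 'rV[R]_d :=
  (x ord0 ord0 : R, @rsubmx R 1 1 d x).

Lemma rV_cons_ord0 p : rV_cons p ord0 ord0 = p.1.
Proof.
transitivity (@row_mx R 1 1 d (p.1 : R)%:M p.2 ord0 (lshift d ord0)).
  by congr (rV_cons _ _ _); exact: val_inj.
by rewrite row_mxEl mxE eqxx mulr1n.
Qed.

Lemma rV_cons_lift p (k : 'I_d) : rV_cons p ord0 (lift ord0 k) = p.2 ord0 k.
Proof.
transitivity (@row_mx R 1 1 d (p.1 : R)%:M p.2 ord0 (rshift 1 k)).
  by congr (rV_cons _ _ _); exact: val_inj.
by rewrite row_mxEr.
Qed.

Lemma measurable_rV_cons : measurable_fun setT rV_cons.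
Proof.
apply: measurable_fun_rV => i.
case: (unliftP ord0 i) => [k|] ->; last first.
  rewrite [X in measurable_fun _ X](_ : _ = fst)//; apply/funext => p.
  exact: rV_cons_ord0.
rewrite [X in measurable_fun _ X](_ : _ =
  (fun x : 'rV[R]_d => x ord0 k : measurableTypeR R) \o snd); last first.
  apply/funext => p /=.
  exact: rV_cons_lift.
by apply: measurableT_comp; [exact: measurable_coord|exact: measurable_snd].
Qed.

Lemma measurable_rV_uncons : measurable_fun setT rV_uncons.
Proof.
apply: measurable_fun_pair; first exact: measurable_coord.
apply: measurable_fun_rV => i.
rewrite [X in measurable_fun _ X](_ : _ =
  fun x : 'rV[R]_(1 + d) => x ord0 (rshift 1 i) : measurableTypeR R).
  exact: measurable_coord.
by apply/funext => x; rewrite mxE.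
Qed.

Lemma rV_consK : cancel rV_cons rV_uncons.
Proof.
case=> a x; rewrite /rV_uncons /= row_mxKr; congr (_, _).
exact: (rV_cons_ord0 (a, x)).
Qed.

Variable mu : {sigma_finite_measure set 'rV[R]_d -> \bar R}.

Definition lebesgue_cons : set 'rV[R]_d.+1 -> \bar R :=
  pushforward (lebesgue_measure \x mu)%E rV_cons.

Let lebesgue_cons0 : lebesgue_cons set0 = 0%E.
Proof. by rewrite /lebesgue_cons /pushforward preimage_set0 measure0. Qed.

Let lebesgue_cons_ge0 A : (0 <= lebesgue_cons A)%E.
Proof. exact: (measure_ge0 (lebesgue_measure \x mu)%E). Qed.

Let lebesgue_cons_sigma_additive : semi_sigma_additive lebesgue_cons.
Proof.
have mpre A : measurable A -> measurable (rV_cons @^-1` A).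
  by move=> mA; rewrite -[X in measurable X]setTI; exact: measurable_rV_cons.
move=> F mF tF mUF; rewrite /lebesgue_cons /pushforward preimage_bigcup.
apply: (measure_semi_sigma_additive (s := (lebesgue_measure \x mu)%E)).
- by move=> n; exact: mpre.
- apply/trivIsetP => /= i j _ _ ij; rewrite -preimage_setI.
  by move/trivIsetP : tF => /(_ _ _ _ _ ij) ->//; rewrite preimage_set0.
- by rewrite -preimage_bigcup; exact: mpre.
Qed.

HB.instance Definition _ := isMeasure.Build _ _ _ lebesgue_cons
  lebesgue_cons0 lebesgue_cons_ge0 lebesgue_cons_sigma_additive.

Let lebesgue_cons_sigma_finite : sigma_finite setT lebesgue_cons.
Proof.
have /sigma_finiteP[F [TF ndF Foo]] := sigma_finiteT (@lebesgue_measure R).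
have /sigma_finiteP[G [TG ndG Goo]] := sigma_finiteT mu.
exists (fun n => rV_uncons @^-1` (F n `*` G n)).
  apply/seteqP; split => // x _ /=.
  have [n _ Fn] : (\bigcup_n F n) (rV_uncons x).1 by rewrite -TF.
  have [k _ Gk] : (\bigcup_n G n) (rV_uncons x).2 by rewrite -TG.
  exists (maxn n k) => //; split.
  - by move: Fn; exact/subsetPset/ndF/leq_maxl.
  - by move: Gk; exact/subsetPset/ndG/leq_maxr.
move=> n; have [mFn Fn] := Foo n; have [mGn Gn] := Goo n; split.
  rewrite -[X in measurable X]setTI; apply: measurable_rV_uncons => //.
  exact: measurableX.
rewrite /lebesgue_cons /pushforward -comp_preimage.
rewrite (_ : rV_uncons \o rV_cons = id) ?preimage_id; last exact/funext/rV_consK.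
by rewrite product_measure1E// lte_mul_pinfty// ge0_fin_numE.
Qed.

HB.instance Definition _ := Measure_isSigmaFinite.Build _ _ _ lebesgue_cons
  lebesgue_cons_sigma_finite.

End lebesgue_rV_step.

(* Lebesgue measure on R^d: a Dirac mass on the one-point space R^0 and, on
   R^(d+1), the image of the product measure under
   (t, x) |-> (t, x_1, ..., x_d). *)
Fixpoint lebesgue_rV (R : realType) (d : nat) :
    {sigma_finite_measure set 'rV[R]_d -> \bar R} :=
  match d with
  | 0 => \d_(0 : 'rV[R]_0)
  | d'.+1 => lebesgue_cons (lebesgue_rV R d')
  end.

Definition volume (R : realType) (d : nat) (A : set 'rV[R]_d) : R :=
  fine (lebesgue_rV R d A).

Definition boundary (R : realType) (d : nat) (A : set 'rV[R]_d) :
    set 'rV[R]_d :=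
  closure A `\` interior A.

Definition hyperplane (R : realType) (d : nat) (p : 'cV[R]_d * R) :
    set 'rV[R]_d :=
  [set x | (x *m p.1) ord0 ord0 = p.2].

(* Polygonal / polyhedral: the boundary is covered by finitely many hyperplanes
   (points, lines, planes for d = 1, 2, 3). *)
Definition polyhedral_domain (R : realType) (d : nat) (Omega : set 'rV[R]_d) :
    Prop :=
  [/\ Omega !=set0, open Omega, connected Omega, bounded_set Omega &
    exists2 H : seq ('cV[R]_d * R), (forall p, p \in H -> p.1 != 0) &
      boundary Omega `<=` \bigcup_(p in [set` H]) hyperplane p].

(* A simplex is given by the set of (indices of) its vertices. *)
Record mesh (R : realType) (d : nat) := Mesh {
  Nv : nat;
  Nvi : nat;
  vertex : 'I_Nv -> 'rV[R]_d;
  elements : {set {set 'I_Nv}} }.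

Arguments Nv {R d} _.
Arguments Nvi {R d} _.
Arguments vertex {R d} _ _.
Arguments elements {R d} _.

Definition hull (R : realType) (d : nat) (Th : mesh R d)
    (K : {set 'I_(Nv Th)}) : set 'rV[R]_d :=
  [set x | exists c : 'I_(Nv Th) -> R,
    [/\ forall i, 0 <= c i, forall i, i \notin K -> c i = 0,
        \sum_i c i = 1 & x = \sum_i c i *: vertex Th i]].

Definition affinely_independent (R : realType) (d : nat) (Th : mesh R d)
    (K : {set 'I_(Nv Th)}) : Prop :=
  forall c : 'I_(Nv Th) -> R, (forall i, i \notin K -> c i = 0) ->
    \sum_i c i = 0 -> \sum_i c i *: vertex Th i = 0 -> forall i, c i = 0.

Definition triangulation (R : realType) (d : nat) (Omega : set 'rV[R]_d)
    (Th : mesh R d) : Prop :=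
  [/\ forall K, K \in elements Th -> #|K| = d.+1 /\ affinely_independent K,
      forall K L, K \in elements Th -> L \in elements Th ->
        hull K `&` hull L = hull (K :&: L),
      closure Omega = \bigcup_(K in [set` elements Th]) hull K,
      forall i, exists2 K, K \in elements Th & i \in K &
      (Nvi Th <= Nv Th)%N /\
      forall i : 'I_(Nv Th), (i < Nvi Th)%N <-> ~ boundary Omega (vertex Th i)].

Definition affine_on (R : realType) (d : nat) (A : set 'rV[R]_d)
    (v : 'rV[R]_d -> R) : Prop :=
  exists (a : 'cV[R]_d) (b : R), forall x, A x -> v x = (x *m a) ord0 ord0 + b.

Definition nodal_basis (R : realType) (d : nat) (Omega : set 'rV[R]_d)
    (Th : mesh R d) (phi : 'I_(Nv Th) -> 'rV[R]_d -> R) : Prop :=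
  forall j, [/\ {within closure Omega, continuous (phi j)},
    forall K, K \in elements Th -> affine_on (hull K) (phi j) &
    forall i, phi j (vertex Th i) = (i == j)%:R].

Definition diffusion_tensor (R : realType) (d : nat) (Omega : set 'rV[R]_d)
    (D : 'rV[R]_d -> 'M[R]_d) : Prop :=
  [/\ {within Omega, continuous D},
      forall i j, (lebesgue_rV R d).-integrable Omega (fun x => (D x i j)%:E),
      forall x, Omega x -> (D x)^T = D x &
      exists2 c : R, 0 < c & forall x, Omega x -> forall xi : 'cV[R]_d,
        c * \sum_k xi k ord0 ^+ 2 <= (xi^T *m D x *m xi) ord0 ord0].

Definition reaction_term (R : realType) (f : R -> R) : Prop :=
  [/\ continuous f, forall v, derivable f v 1, continuous (derive1 f) &
      forall b : R, exists c : R, forall v, `|v| <= b ->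
        `|f v| <= c /\ `|derive1 f v| <= c].

Definition grad (R : realType) (d : nat) (v : 'rV[R]_d -> R) (x : 'rV[R]_d) :
    'cV[R]_d :=
  \col_k 'D_(delta_mx ord0 k) v x.

(* The maximum of v over A: for A the closure of a bounded domain and v
   continuous on A, the supremum is attained. *)
Definition max_over (R : realType) (d : nat) (A : set 'rV[R]_d)
    (v : 'rV[R]_d -> R) : R :=
  sup (v @` A).

Section scheme.
Context {R : realType} {d : nat}.
Variables (Omega : set 'rV[R]_d) (Th : mesh R d).
Variable phi : 'I_(Nv Th) -> 'rV[R]_d -> R.
Variables (D : 'rV[R]_d -> 'M[R]_d) (f : R -> R).

Local Notation mu := (lebesgue_rV R d).

Definition mass_mx : 'M[R]_(Nv Th) :=
  \matrix_(i, j) if (i < Nvi Th)%N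
    then \int[mu]_(x in Omega) (phi j x * phi i x) else 0.

Definition weighted_mass_mx (w : 'rV[R]_d -> R) : 'M[R]_(Nv Th) :=
  \matrix_(i, j) if (i < Nvi Th)%N
    then \int[mu]_(x in Omega) (w x * phi j x * phi i x) else 0.

(* The gradients exist off the faces of the elements, hence almost
   everywhere. *)
Definition stiffness_mx : 'M[R]_(Nv Th) :=
  \matrix_(i, j) if (i < Nvi Th)%N
    then \int[mu]_(x in Omega)
           ((grad (phi i) x)^T *m D x *m grad (phi j) x) ord0 ord0
    else (i == j)%:R.

Definition uh (v : 'cV[R]_(Nv Th)) (x : 'rV[R]_d) : R :=
  \sum_j v j ord0 * phi j x.

(* u f'(u) and f(u) + u f'(u), for u = u_h *)
Definition uh_df (v : 'cV[R]_(Nv Th)) (x : 'rV[R]_d) : R :=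
  uh v x * derive1 f (uh v x).

Definition f_uh_df (v : 'cV[R]_(Nv Th)) (x : 'rV[R]_d) : R :=
  f (uh v x) + uh_df v x.

Definition B_mx (v : 'cV[R]_(Nv Th)) : 'M[R]_(Nv Th) :=
  weighted_mass_mx (f_uh_df v).

Definition C_mx (v : 'cV[R]_(Nv Th)) : 'M[R]_(Nv Th) :=
  - weighted_mass_mx (uh_df v).

Definition boundary_vec (g : 'rV[R]_d -> R -> R) (t : R) : 'cV[R]_(Nv Th) :=
  \col_i if (i < Nvi Th)%N then 0 else g (vertex Th i) t.

(* (|Omega| / N_e) ^ (2 / d) *)
Definition mesh_scale : R :=
  (volume Omega / #|elements Th|%:R) `^ (2 / d%:R).

(* D is only defined on Omega; hull K minus Omega is negligible. *)
Definition D_avg (K : {set 'I_(Nv Th)}) : 'M[R]_d :=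
  \matrix_(k, l)
    ((volume (hull K))^-1 * \int[mu]_(x in hull K `&` Omega) D x k l).

Definition barycenter (K : {set 'I_(Nv Th)}) : 'rV[R]_d :=
  #|K|%:R^-1 *: \sum_(i in K) vertex Th i.

(* phi i is affine on K: its gradient on K is its gradient at any interior
   point. *)
Definition grad_on (K : {set 'I_(Nv Th)}) (i : 'I_(Nv Th)) : 'cV[R]_d :=
  grad (phi i) (barycenter K).

(* inf is over a finite set: it is the minimum over the elements K and the
   pairs of distinct vertices of K. *)
Definition D_acute : R :=
  mesh_scale *
  inf [set r | exists K i j,
    [/\ K \in elements Th, i \in K, j \in K, i != j &
        r = - ((grad_on K i)^T *m D_avg K *m grad_on K j) ord0 ord0]].

(* max |(f(u_h) + u_h f'(u_h))^-| over the closed domain *)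
Definition max_neg (v : 'cV[R]_(Nv Th)) : R :=
  max_over (closure Omega) (fun x => `|Num.min (f_uh_df v x) 0|).

Definition max_pos (v : 'cV[R]_(Nv Th)) : R :=
  max_over (closure Omega)
    (fun x => Num.max (Num.max (uh_df v x) 0) (Num.max (f_uh_df v x) 0)).

End scheme.

(* Main.v *)
Require Import Defs.
From HB Require Import structures.
From mathcomp Require Import all_boot all_order all_algebra.
From mathcomp Require Import all_classical all_reals all_analysis.
From mathcomp Require Import measurable_realfun zify ring lra.

(* On interior rows the system matrix has nonpositive off-diagonal entries and
   positive row sums, on boundary rows it is a multiple of the identity, and the
   right-hand side is nonnegative; at a negative minimal entry of the solution
   the corresponding row would then have a negative left-hand side.

   The entries are sums over the elements.  On an element K the basis functions
   are the barycentric coordinates lam_i, and the sign of an off-diagonal entry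
   comes from int_K lam_i lam_j <= |K| / ((d + 1) (d + 2)).  This bound avoids
   any change of variables beyond homotheties: the corner {lam_i > s, lam_j > t}
   of K is a copy of K of ratio 1 - s - t, hence has volume (1 - s - t)^d |K|,
   and lam_i is at most the average over k < n of the indicators of
   {lam_i > k / n}.  Homotheties also show that the boundary of K is a null set
   and that int_K phi_i > 0.  That every |K| is positive and finite is read off
   the mesh condition, as D_K would be 0 otherwise. *)

Import Order.TTheory GRing.Theory Num.Theory.
Import numFieldNormedType.Exports.

Set Implicit Arguments.
Unset Strict Implicit.
Unset Printing Implicit Defensive.

Local Open Scope classical_set_scope.
Local Open Scope ring_scope.

(** * Linear algebra and arithmetic *)

Lemma mmatrix_ge0 (R : realFieldType) n (L : 'M[R]_n) (v : 'cV[R]_n)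
    (P : pred 'I_n) :
  (forall i, ~~ P i -> 0 <= v i ord0) ->
  (forall i j, P i -> i != j -> L i j <= 0) ->
  (forall i, P i -> 0 < \sum_j L i j) ->
  (forall i, P i -> 0 <= (L *m v) i ord0) ->
  forall i, 0 <= v i ord0.
Proof.
move=> vP Loff Lsum Lv i.
have [k _ kmin] := @arg_minP _ _ _ i xpredT (fun k => v k ord0) isT.
apply: (le_trans _ (kmin i isT)); rewrite leNgt; apply/negP => vk0.
have [Pk|/vP] := boolP (P k); last by rewrite leNgt vk0.
have := Lv k Pk; rewrite leNgt => /negP; apply.
(* Off the diagonal [L k j <= 0] and [v k <= v j], so replacing each [v j] by the minimum [v k] only
   increases the sum. What remains is the row sum times [v k]. *)
rewrite mxE; apply: (@le_lt_trans _ _ (\sum_j L k j * v k ord0)).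
  apply: ler_sum => j _; have [<-//|kj] := eqVneq k j.
  by rewrite ler_wnM2l ?Loff// kmin.
by rewrite -mulr_suml pmulr_rlt0// Lsum.
Qed.

(** * Power sums over the naturals *)

Section discrete_sums.
Local Open Scope nat_scope.

(** These are the first two terms of the binomial expansion of [x.+1 ^ e.+1]. The bound serves as a
    discrete derivative in the sums below. *)
Lemma leq_expSn_add e x : x ^ e.+1 + e.+1 * x ^ e <= x.+1 ^ e.+1.
Proof.
elim: e => [|e IH]; first by rewrite !expn1 expn0 addn1.
rewrite [leqRHS]expnS (leq_trans _ (leq_mul (leqnn x.+1) IH))//.
rewrite [x ^ e.+2]expnS [x ^ e.+1]expnS.
set y := x ^ e; nia.
Qed.

(** Discrete form of the integral of x^d, obtained by telescoping [leq_expSn_add]. Subtraction is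
    truncated and [0 < d], so the terms with [l >= m] vanish and [n] may be arbitrary. *)
Lemma leq_sum_exp d n m : 0 < d ->
  d.+1 * (\sum_(l < n) (m - l) ^ d) <= m.+1 ^ d.+1.
Proof.
move=> d0; elim: n m => [|n IH] m; first by rewrite big_ord0 muln0.
rewrite big_ord_recl subn0; case: m => [|m].
  by rewrite exp0n// big1 ?muln0.
under eq_bigr => i _ do rewrite lift0 subSS.
rewrite mulnDr (leq_trans _ (leq_expSn_add d m.+1))// addnC leq_add//.
Qed.

(** Discrete form of the Dirichlet integral of (1 - s - t)^d over the triangle s + t <= 1, whose
    value is 1 / ((d + 1) (d + 2)). *)
Lemma leq_sum2_exp d n m : 0 < d ->
  d.+1 * d.+2 * (\sum_(k < n) \sum_(l < n) (m - k - l) ^ d) <= m.+2 ^ d.+2.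
Proof.
(* The two ranges are separated because the induction shortens only the outer sum. *)
move=> d0; suff H p q : d.+1 * d.+2 * (\sum_(k < p) \sum_(l < q) (m - k - l) ^ d)
   <= m.+2 ^ d.+2 by exact: H.
elim: p m => [|p IH] m; first by rewrite big_ord0 muln0.
rewrite big_ord_recl subn0; case: m => [|m].
  rewrite !big1 ?muln0// => i _; last by rewrite exp0n.
under [X in _ + X]eq_bigr => i _ do under eq_bigr => j _ do rewrite lift0 subSS.
rewrite mulnDr (leq_trans _ (leq_expSn_add d.+1 m.+2))// addnC leq_add//.
by rewrite [d.+1 * _]mulnC -mulnA leq_mul2l leq_sum_exp.
Qed.

End discrete_sums.

(** * Averages of threshold indicators, and limits of the discretisation error *)

Section counting_bound.
Context (R : realType).

Lemma le_sum_lt_nat (y : R) n : y <= n%:R -> y <= \sum_(k < n) (k%:R < y)%R%:R.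
Proof.
elim: n => [|n IH] yn; first by rewrite big_ord0.
have [ny|yn'] := ltP n%:R y; last first.
  by rewrite big_ord_recr/= (le_trans (IH yn'))// lerDl ler0n.
rewrite (le_trans yn)// [leLHS](_ : _ = \sum_(k < n.+1) 1); last first.
  by rewrite sumr_const card_ord.
apply: ler_sum => k _; rewrite (le_lt_trans _ ny)// ler_nat -ltnS//.
Qed.

(** Discrete layer-cake bound: [le_sum_lt_nat] for [n.+1 * a], divided by [n.+1]. *)
Lemma le_avg_lt_nat (a : R) n : a <= 1 ->
  a <= n.+1%:R^-1 * \sum_(k < n.+1) (k%:R / n.+1%:R < a)%R%:R.
Proof.
move=> a1; rewrite ler_pdivlMl//.
rewrite (le_trans (@le_sum_lt_nat _ n.+1 _)) ?ger_pMr//.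
by apply: ler_sum => k _; rewrite ltr_pdivrMr// mulrC.
Qed.

Lemma cvg_1Dharmonic (c : R) p :
  (fun n => (1 + c / n.+1%:R) ^+ p) @ \oo --> (1 : R).
Proof.
rewrite -[X in _ --> X](expr1n _ p).
have h : (fun n => 1 + c / n.+1%:R) @ \oo --> (1 : R).
  rewrite -[X in _ --> X]addr0; apply: cvgD; first exact: cvg_cst.
  rewrite -[X in _ --> X](mulr0 c); apply: cvgM; first exact: cvg_cst.
  exact: cvg_harmonic.
exact: (cvg_comp _ _ h (@exprn_continuous R p 1)).
Qed.

(** Removes the factor left by a subdivision into [n.+1] parts, by letting [n] tend to infinity. *)
Lemma le_mul_1Dharmonic (x y c : R) p :
  (forall n, x <= y * (1 + c / n.+1%:R) ^+ p) -> x <= y.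
Proof.
move=> h; rewrite -[y]mulr1.
have cv : (fun n => y * (1 + c / n.+1%:R) ^+ p) @ \oo --> y * 1.
  by apply: cvgM; [exact: cvg_cst|exact: cvg_1Dharmonic].
rewrite -(cvg_lim _ cv)//; apply: limr_ge; first exact/cvgP/cv.
by near=> n; exact: h.
Unshelve. all: by end_near. Qed.

End counting_bound.

(** * Integration and Lebesgue measure on R^d *)

Section integral_null.
Local Open Scope ereal_scope.
Import HBNNSimple.
Context (dd : measure_display) (T : measurableType dd) (R : realType).
Variable mu : {measure set T -> \bar R}.

Lemma ge0_integral_setD_null (D N : set T) (f : T -> \bar R) :
  measurable N -> mu N = 0 -> (forall x, 0 <= f x) ->
  \int[mu]_(x in D) f x = \int[mu]_(x in D `\` N) f x.
Proof.
move=> mN N0 f0; rewrite !ge0_integralE//.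
apply/eqP; rewrite eq_le; apply/andP; split.
- apply: ge_ereal_sup => _ [h /= hf <-].
  apply: ereal_sup_ubound; exists (proj_nnsfun h (measurableC mN)) => /=.
    move=> x; rewrite mindicE.
    have [xN|xN] := boolP (x \in ~` N); last first.
      by rewrite mulr0 /patch; case: ifP.
    rewrite mulr1 (le_trans (hf x))// /patch; case: ifPn => xD; last by case: ifP.
    by rewrite mem_set//; split; apply/set_mem.
  have sE (p : {nnsfun T >-> R}) : sintegral mu p = \int[mu]_x (p x)%:E.
    by rewrite integral_nnsfun// patch_setT.
  rewrite (sE h) (sE (proj_nnsfun h (measurableC mN))).
  apply: ae_eq_integral => //.
  - exact/measurable_EFinP.
  - exact/measurable_EFinP.
  exists N; split => // x /= xh; apply: contrapT => Nx; apply: xh => _.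
  by rewrite mindicE mem_set// mulr1.
- apply: ereal_sup_le => _ [h /= hf <-]; exists h => //= x.
  apply: (le_trans (hf x)); rewrite /patch.
  have [/set_mem[Dx _]|_] := boolP (x \in D `\` N); first by rewrite mem_set.
  by case: ifP.
Qed.

(* No measurability of [f] is assumed: a null measurable set contributes
   nothing to the suprema defining the integral. *)
Lemma integral_setD_null (D N : set T) (f : T -> \bar R) :
  measurable N -> mu N = 0 ->
  \int[mu]_(x in D) f x = \int[mu]_(x in D `\` N) f x.
Proof.
move=> mN N0; rewrite integralE [RHS]integralE.
by congr (_ - _); exact: ge0_integral_setD_null.
Qed.

End integral_null.

(** * Affine changes of variable on the line *)

Section lebesgue_affine.
Context (R : realType).
Implicit Types c r : R.

Definition aff1 c r : measurableTypeR R -> measurableTypeR R :=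
  fun s => c + r * s.

Lemma measurable_aff1 c r : measurable_fun setT (aff1 c r).
Proof. by apply: measurable_funD => //; exact: measurable_funM. Qed.

Lemma lebesgue_measure_aff1 c r (A : set (measurableTypeR R)) : 0 < r ->
  measurable A ->
  (lebesgue_measure (aff1 c r @^-1` A) = r^-1%:E * lebesgue_measure A)%E.
Proof.
move=> r0 mA.
have [m mE] : exists m : {measure set (measurableTypeR R) -> \bar R},
    forall B, m B = lebesgue_measure (aff1 c r @^-1` B).
  unshelve eexists [the measure _ _ of pushforward lebesgue_measure (aff1 c r)].
    exact: measurable_aff1.
  by [].
(* The image measure scaled by [r] agrees with Lebesgue measure on half-open intervals, hence
   everywhere by uniqueness. *)
have E : lebesgue_measure A = mscale (NngNum (ltW r0)) m A.
  apply: lebesgue_measure_unique => //= _ [[a b]] _ <-.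
  rewrite /mscale /= mE.
  have -> : aff1 c r @^-1` `]a, b] = `](a - c) / r, (b - c) / r]%classic.
    apply/seteqP; split => x /=; rewrite !in_itv/= /aff1.
      by rewrite ltr_pdivrMr// ler_pdivlMr// ltrBlDl lerBrDl mulrC.
    by rewrite ltr_pdivrMr// ler_pdivlMr// ltrBlDl lerBrDl mulrC.
  rewrite !lebesgue_measure_itv/= !lte_fin ltr_pM2r ?invr_gt0// ltrD2r.
  case: ifPn => _; last by rewrite mule0.
  by rewrite -!EFinB -EFinM; congr EFin; field; rewrite gt_eqF.
by rewrite E /mscale/= mE muleA -EFinM mulVf ?gt_eqF// mul1e.
Qed.

Lemma integral_aff1 c r (G : measurableTypeR R -> \bar R) : 0 < r ->
  measurable_fun setT G -> (forall s, (0 <= G s)%E) ->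
  (\int[lebesgue_measure]_s G (aff1 c r s) =
   r^-1%:E * \int[lebesgue_measure]_s G s)%E.
Proof.
move=> r0 mG G0.
have mr := measurable_aff1 c r.
have r0' : 0 <= r^-1 by rewrite invr_ge0 ltW.
rewrite -(ge0_integral_mscale lebesgue_measure measurableT (NngNum r0'))//.
have := ge0_integral_pushforward mr lebesgue_measure measurableT mG.
rewrite preimage_setT /= => <-//.
apply: eq_measure_integral => //= A mA _.
by rewrite /mscale/= /pushforward lebesgue_measure_aff1.
Qed.

End lebesgue_affine.

Lemma Rintegral_sum (dd : measure_display) (T : measurableType dd)
    (R : realType) (mu : {measure set T -> \bar R}) (D : set T) (I : Type)
    (s : seq I)
    (f : I -> T -> R) :
  measurable D -> (forall i, mu.-integrable D (EFin \o f i)) ->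
  \int[mu]_(x in D) (\sum_(i <- s) f i x) = \sum_(i <- s) \int[mu]_(x in D) f i x.
Proof.
move=> mD intf; rewrite /Rintegral.
under eq_integral => x _ do rewrite -sumEFin.
rewrite integral_sum// sum_fine// => i _.
by apply: integrable_fin_num (intf i).
Qed.

(** * Measurability of open sets of R^d *)

Section measurable_rV_open.
Context (R : realType) (d : nat).

Lemma measurable_ball_rV (x : 'rV[R]_d) (e : R) : measurable (ball x e).
Proof.
(* A ball of nonpositive radius is empty, whereas for [d = 0] the intersection over the coordinates
   would be the whole space. *)
have [e0|e0] := leP e 0.
  rewrite (_ : ball x e = set0)// -subset0 => y [].
  by rewrite ltNge e0.
rewrite (_ : ball x e =
    \bigcap_(i : 'I_d) [set y | ball (x ord0 i) e (y ord0 i)]).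
  apply: fin_bigcap_measurable => // i _.
  have := @measurable_coord R d i measurableT _ (measurable_ball (x ord0 i) e).
  by rewrite setTI.
apply/seteqP; split => y /= => [[_ h] i _|h]; first exact: h.
by split => // i j; rewrite ord1; exact: h.
Qed.

Lemma open_measurable_rV (U : set 'rV[R]_d) : open U -> measurable U.
Proof.
move=> oU.
(* Balls with rational centre and radius [1 / n.+1] form a countable family, indexed through
   [unpickle]. Those contained in [U] cover it. *)
pose B (p : 'rV[rat]_d * nat) : set 'rV[R]_d :=
  ball (map_mx (@ratr R) p.1) (p.2.+1%:R^-1 : R).
pose F (k : nat) : set 'rV[R]_d :=
  if unpickle k is Some p then (if `[< B p `<=` U >] then B p else set0)
  else set0.
rewrite (_ : U = \bigcup_k F k).
  apply: bigcupT_measurable => k; rewrite /F; case: unpickle => // p.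
  by case: asboolP => // _; exact: measurable_ball_rV.
apply/seteqP; split => x.
  move=> Ux; have /nbhs_ballP[e /= e0 eU] := open_nbhs_nbhs (conj oU Ux).
  (* With radius below [e / 2], any such ball containing [x] lies in [ball x e] by the triangle
     inequality. *)
  have [n ne] : exists n, n.+1%:R^-1 < e / 2.
    have [n _ h] := cvgr0_norm_lt _ (@cvg_harmonic R) _ (divr_gt0 e0 (ltr0n _ 2)).
    by exists n; have := h n (leqnn n); rewrite ger0_norm ?invr_ge0.
  have n0 : 0 < n.+1%:R^-1 :> R by rewrite invr_gt0.
  have /choice[q qE] (i : 'I_d) :
      exists q : rat, `|x ord0 i - ratr q| < n.+1%:R^-1.
    have [|q] := @rat_in_itvoo R (x ord0 i - n.+1%:R^-1) (x ord0 i + n.+1%:R^-1).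
      by rewrite ltrD2l gtrN.
    rewrite in_itv/= => /andP[q1 q2]; exists q; rewrite ltr_norml.
    move: q1 q2; set e' := _^-1; set y := ratr q; set z := x _ _ => q1 q2.
    by apply/andP; split; lra.
  have Bx : B (\row_i q i, n) x.
    split => // i j; rewrite ord1 !mxE /ball/= distrC; exact: qE.
  exists (pickle (\row_i q i, n)) => //; rewrite /F pickleK asboolT//.
  move=> y By; apply: eU.
  apply: (@le_ball _ _ _ (n.+1%:R^-1 + n.+1%:R^-1)).
    by rewrite [leRHS]splitr ltW// ltrD.
  apply: (@ball_triangle _ _ (map_mx (@ratr R) (\row_i q i))) => //.
  exact: ball_sym.
move=> [k _]; rewrite /F; case: unpickle => // p.
by case: asboolP => // pU /pU.
Qed.

End measurable_rV_open.

(** * Scaling of Lebesgue measure under homotheties *)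

Section lebesgue_homothety.
Context (R : realType).

Lemma rV_cons_affine d (c : 'rV[R]_d.+1) (r : R) (s : measurableTypeR R)
    (x : 'rV[R]_d) :
  c + r *: rV_cons (s, x) =
  rV_cons (aff1 (c ord0 ord0) r s, (rV_uncons c).2 + r *: x).
Proof.
have E m (v y : 'rV[R]_m) i : (v + r *: y) ord0 i = v ord0 i + r * y ord0 i.
  by rewrite !mxE.
apply/rowP => i; rewrite E.
case: (unliftP ord0 i) => [k|] ->; last by rewrite !rV_cons_ord0.
rewrite !rV_cons_lift /= E; congr (_ + _).
by rewrite mxE; congr (c ord0 _); exact: val_inj.
Qed.

Lemma xsection_homothety d (c : 'rV[R]_d.+1) (r : R) (A : set 'rV[R]_d.+1)
    (s : measurableTypeR R) :
  xsection (rV_cons (d:=d) @^-1` ((fun x => c + r *: x) @^-1` A)) s =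
  (fun x => (rV_uncons c).2 + r *: x) @^-1`
    xsection (rV_cons (d:=d) @^-1` A) (aff1 (c ord0 ord0) r s).
Proof.
by apply/seteqP; split => x; rewrite /xsection/= !inE/= rV_cons_affine.
Qed.

(** Induction on the dimension by slicing along the first coordinate. The slices of the preimage are
    homothetic preimages of slices of [A], which gives [r^-1 ^+ d], and the substitution in the
    first coordinate gives the last factor. *)
Lemma lebesgue_rV_homothety d (c : 'rV[R]_d) (r : R) (A : set 'rV[R]_d) :
  0 < r -> measurable A ->
  (lebesgue_rV R d ((fun x => c + r *: x)%R @^-1` A) =
   (r^-1 ^+ d)%:E * lebesgue_rV R d A)%E.
Proof.
move=> r0; elim: d c A => [|d IH] c A mA.
  rewrite /= !diracE expr0 mul1e; congr (_%:R%:E); apply: congr1.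
  by apply/idP/idP; rewrite !inE/= (thinmx0 (c + _)).
rewrite /= /lebesgue_cons /pushforward /product_measure1.
have mA' : measurable (rV_cons (d:=d) @^-1` A).
  by rewrite -[X in measurable X]setTI; exact: measurable_rV_cons.
pose G s := lebesgue_rV R d (xsection (rV_cons (d:=d) @^-1` A) s).
transitivity (\int[lebesgue_measure]_s
    ((r^-1 ^+ d)%:E * (G (aff1 (c ord0 ord0) r s))))%E.
  apply: eq_integral => s _ /=; rewrite xsection_homothety IH//.
  exact: measurable_xsection.
have mG : measurable_fun setT G by exact: measurable_fun_xsection.
have rd0 : 0 <= r^-1 ^+ d by rewrite exprn_ge0// invr_ge0 ltW.
have mGa : measurable_fun setT (G \o aff1 (c ord0 ord0) r).
  exact: (measurableT_comp mG (measurable_aff1 _ _)).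
rewrite ge0_integralZl//.
rewrite integral_aff1//.
by rewrite muleA -EFinM -exprSr.
Qed.

End lebesgue_homothety.

(** * Simplices *)

Lemma measurable_homothety (R : realType) d (c : 'rV[R]_d) (r : R) :
  measurable_fun setT (fun y : 'rV[R]_d => c + r *: y).
Proof.
apply: measurable_fun_rV => k.
rewrite (_ : (fun y => _) = fun y : 'rV[R]_d => c ord0 k + r * y ord0 k).
  apply: measurable_funD => //; apply: measurable_funM => //.
  exact: measurable_coord.
by apply/funext => y; rewrite !mxE.
Qed.

Section simplex.
Context (R : realType) (d : nat) (I : finType).
Variables (K : {set I}) (x : I -> 'rV[R]_d) (a : I -> 'cV[R]_d) (b : I -> R).

Definition affine_fun i (y : 'rV[R]_d) : R := (y *m a i) ord0 ord0 + b i.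

Local Notation lam := affine_fun.

(** Under [cardK] and [lamE] below, the [lam i] become the barycentric coordinates with respect to
    the vertices [x i]. *)
Definition simplex : set 'rV[R]_d := [set y | forall i, i \in K -> 0 <= lam i y].

(** Strict inequalities stand in for the topological interior. *)
Definition core : set 'rV[R]_d := [set y | forall i, i \in K -> 0 < lam i y].

(** Three points serve the corner cut off along two vertices. Homotheties with a single centre use
    it with [q = 0]. *)
Lemma affine_fun_comb i (p q r : R) u v y : p + q + r = 1 ->
  lam i (p *: u + q *: v + r *: y) = p * lam i u + q * lam i v + r * lam i y.
Proof.
move=> pqr; rewrite /lam !mulmxDl -!scalemxAl !mxE.
rewrite -[X in _ + X = _]mul1r -pqr; ring.
Qed.

Lemma measurable_affine_fun i : measurable_fun setT (lam i).
Proof.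
apply: measurable_funD => //.
rewrite (_ : (fun y => _) = fun y : 'rV[R]_d => \sum_k y ord0 k * a i k ord0).
  apply: measurable_sum => k; apply: measurable_funM => //.
  exact: measurable_coord.
by apply/funext => y; rewrite mxE.
Qed.

Lemma measurable_affine_fun_gt i u : measurable [set y | u < lam i y].
Proof.
rewrite (_ : [set y | _] = lam i @^-1` `]u, +oo[).
  rewrite -[X in measurable X]setTI; exact: measurable_affine_fun.
by apply/seteqP; split => y /=; rewrite in_itv/= andbT.
Qed.

Lemma measurable_simplex : measurable simplex.
Proof.
rewrite (_ : simplex = \bigcap_(i in [set` K]) (lam i @^-1` `[0, +oo[)).
  apply: fin_bigcap_measurable => // i _; rewrite -[X in measurable X]setTI.
  exact: measurable_affine_fun.
by apply/seteqP; split => y h i /= iK; have := h i iK; rewrite /= in_itv/= andbT.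
Qed.

Lemma measurable_core : measurable core.
Proof.
rewrite (_ : core = \bigcap_(i in [set` K]) (lam i @^-1` `]0, +oo[)).
  apply: fin_bigcap_measurable => // i _; rewrite -[X in measurable X]setTI.
  exact: measurable_affine_fun.
by apply/seteqP; split => y h i /= iK; have := h i iK; rewrite /= in_itv/= andbT.
Qed.

Lemma sub_core : core `<=` simplex.
Proof. by move=> y h i /h/ltW. Qed.

Hypothesis cardK : #|K| = d.+1.
Hypothesis lamE : forall i j, i \in K -> j \in K -> lam i (x j) = (j == i)%:R.

(** The index type ['I_(1 + d)] fits the block matrices made of one constant column and [d]
    coordinates. *)
Let e (k : 'I_(1 + d)) : I := enum_val (cast_ord (esym cardK) k).

Let e_in k : e k \in K. Proof. exact: enum_valP. Qed.

Let e_inj : injective e.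
Proof. by move=> k l /enum_val_inj/cast_ord_inj. Qed.

Let big_e (V : nmodType) (F : I -> V) : \sum_(i in K) F i = \sum_k F (e k).
Proof.
rewrite big_enum_val (reindex (cast_ord (esym cardK)))//=.
by apply: onW_bij; exists (cast_ord cardK) => k; apply: val_inj.
Qed.

(* The matrix of vertices (x_k, 1) is inverse to that of the affine functions,
   on either side. *)
Let bary_row (y : 'rV[R]_d) :
  (\row_k lam (e k) y) *m
    row_mx (const_mx 1 : 'M[R]_(1 + d, 1)) (\matrix_k x (e k))
  = row_mx (const_mx 1) y.
Proof.
set V := row_mx _ _.
pose L : 'M[R]_(1 + d) :=
  col_mx (\row_k b (e k)) (\matrix_(l, k) a (e k) l ord0).
have lamL z : row_mx (const_mx 1) z *m L = \row_k lam (e k) z.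
  apply/rowP => k; rewrite /L mul_row_col !mxE /affine_fun addrC; congr (_ + _).
    by rewrite mxE; apply: eq_bigr => l _; rewrite !mxE.
  by rewrite big_ord1 !mxE mul1r.
have VL : V *m L = 1%:M.
  apply/row_matrixP => k; rewrite row_mul /V row_row_mx row_const rowK lamL.
  by apply/rowP => l; rewrite !mxE lamE//= (inj_eq e_inj).
by rewrite -lamL -mulmxA (mulmx1C VL) mulmx1.
Qed.

Lemma sum_affine_fun y : \sum_(i in K) lam i y = 1.
Proof.
have := bary_row y; rewrite mul_mx_row => /eq_row_mx[/rowP/(_ ord0) h _]; move: h.
rewrite big_e !mxE => <-; apply: eq_bigr => k _.
by rewrite !mxE mulr1.
Qed.

Lemma affine_fun_bary y : \sum_(i in K) lam i y *: x i = y.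
Proof.
have := bary_row y; rewrite mul_mx_row => /eq_row_mx[_ h]; rewrite -[RHS]h.
rewrite mulmx_sum_row big_e; apply: eq_bigr => k _.
by rewrite rowK mxE.
Qed.

Lemma affine_fun_le1 i y : i \in K -> simplex y -> lam i y <= 1.
Proof.
move=> iK Sy; rewrite -(sum_affine_fun y) (bigD1 i)//= lerDl.
by apply: sumr_ge0 => j /andP[jK _]; exact: Sy.
Qed.

(** The sum of the [lam i] is constantly 1, so its linear part vanishes. This is read off by
    comparing the unit vectors with the origin. *)
Lemma sum_linear_fun : \sum_(i in K) a i = 0.
Proof.
apply/colP => l; rewrite summxE.
have := sum_affine_fun (delta_mx ord0 l).
rewrite -(sum_affine_fun 0) /affine_fun big_split/= [RHS]big_split/=.
move=> /addIr; rewrite [X in _ = X]big1 => [h|i _]; last by rewrite mul0mx mxE.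
by rewrite mxE -[RHS]h; apply: eq_bigr => i _; rewrite -rowE mxE.
Qed.

Local Notation mu := (lebesgue_rV R d).

(* The cut-off corner is the homothetic image of the simplex of ratio
   [1 - s - t]. *)
Lemma corner_le i j (s t : R) : i \in K -> j \in K -> i != j ->
  0 <= s -> 0 <= t -> 0 < 1 - s - t ->
  (mu (simplex `&` [set y | (s < lam i y)%R] `&` [set y | (t < lam j y)%R]) <=
   ((1 - s - t) ^+ d)%:E * mu simplex)%E.
Proof.
move=> iK jK ij s0 t0 r0; set r := 1 - s - t in r0 *; set A := _ `&` _.
have mA : measurable A.
  apply: measurableI; last exact: measurable_affine_fun_gt.
  by apply: measurableI; [exact: measurable_simplex|exact: measurable_affine_fun_gt].
have := lebesgue_rV_homothety (s *: x i + t *: x j) r0 mA.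
set B := _ @^-1` A => muB.
(* At [s *: x i + t *: x j + r *: y] the coordinate [i] is [s + r * lam i y], so exceeding [s] means
   [lam i y > 0]. The same holds for [j] and [t], and the other coordinates are just scaled by
   [r]. *)
have BS : B `<=` simplex.
  move=> y [[/= Sy sy] ty] k kK.
  have E : s + t + r = 1 by rewrite /r; ring.
  have := Sy k kK; rewrite affine_fun_comb//.
  move: sy ty; rewrite !affine_fun_comb// !lamE// !eqxx eq_sym (negbTE ij).
  rewrite [i == k]eq_sym [j == k]eq_sym.
  rewrite !mulr1 !mulr0 addr0 add0r !ltrDl !pmulr_rgt0//.
  move=> ly0 lj0; have [->|ki] := eqVneq k i; first by move=> _; exact: ltW.
  have [->|kj] := eqVneq k j; first by move=> _; exact: ltW.
  by rewrite !mulr0 !add0r pmulr_rge0.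
have mB : measurable B.
  by rewrite -[X in measurable X]setTI; exact: measurable_homothety.
have : (mu B <= mu simplex)%E.
  by apply: le_measure; rewrite ?inE//; exact: measurable_simplex.
rewrite muB => h.
rewrite -[leLHS]mul1e -(mulfV (lt0r_neq0 (exprn_gt0 d r0))) EFinM -muleA.
rewrite -exprVn.
by rewrite lee_wpmul2l// lee_fin exprn_ge0// ltW.
Qed.

(** Each barycentric coordinate equals [1 / #|K|] there. The point serves as a centre of homothety
    and as the place where [grad_on] takes its gradients. *)
Lemma core_barycenter : core (#|K|%:R^-1 *: \sum_(j in K) x j).
Proof.
move=> i iK; set n := _%:R.
have n0 : n != 0 by rewrite /n cardK.
have -> : lam i (n^-1 *: \sum_(j in K) x j) = n^-1 * \sum_(j in K) lam i (x j).
  rewrite /affine_fun big_split/= sumr_const -scalemxAl mxE mulmx_suml summxE.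
  by rewrite mulrDr -[b i *+ _]mulr_natl mulrA mulVf// mul1r.
rewrite (bigD1 i)//= big1 ?addr0 => [|j /andP[jK /negbTE ji]].
  by rewrite lamE// eqxx mulr1 invr_gt0 /n cardK.
by rewrite lamE// ji.
Qed.

Hypothesis fin_mu : (mu simplex < +oo)%E.

Let v := fine (mu simplex).

Let muE : mu simplex = v%:E.
Proof. by rewrite fineK// ge0_fin_numE. Qed.

(** Shrinking the simplex towards its barycenter by a ratio [r < 1] maps it into the core, so its
    volume is at most [r^-1 ^+ d] times that of the core. Here [r^-1] is [1 + 1 / n.+1]. *)
Let le_mu_core n : v <= fine (mu core) * (1 + 1 / n.+1%:R) ^+ d.
Proof.
pose r : R := (1 + 1 / n.+1%:R)^-1.
have r0' : 1 < r^-1 by rewrite invrK ltrDl divr_gt0.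
have r0 : 0 < r by rewrite -invr_gt0 (lt_trans _ r0').
have r1 : r < 1 by rewrite -(invrK r) invf_lt1// (lt_trans _ r0').
pose g := #|K|%:R^-1 *: \sum_(j in K) x j.
have fc : (mu core < +oo)%E.
  apply: le_lt_trans fin_mu; apply: le_measure; rewrite ?inE.
  - exact: measurable_core.
  - exact: measurable_simplex.
  - exact: sub_core.
have := lebesgue_rV_homothety ((1 - r) *: g) r0 measurable_core.
set B := _ @^-1` core => muB.
have : (mu simplex <= mu B)%E.
  apply: le_measure; rewrite ?inE.
  - exact: measurable_simplex.
  - rewrite -[X in measurable X]setTI; apply: measurable_homothety => //.
    exact: measurable_core.
  move=> y Sy i iK; have r01 : 1 - r + 0 + r = 1 by ring.
  have := affine_fun_comb i g g y r01; rewrite scale0r addr0 => ->.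
  rewrite mul0r addr0 ltr_wpDr//; first by rewrite mulr_ge0 ?Sy// ltW.
  by rewrite mulr_gt0 ?subr_gt0//; exact: core_barycenter.
rewrite muB muE invrK -[mu core]fineK ?ge0_fin_numE//.
by rewrite -EFinM lee_fin mulrC.
Qed.

Lemma simplexD_core_null : mu (simplex `\` core) = 0%E.
Proof.
have mS := measurable_simplex; have mC := measurable_core.
rewrite measureD// (setIidr sub_core).
have cS : (mu core <= mu simplex)%E.
  by apply: le_measure; rewrite ?inE//; exact: sub_core.
have cE : mu core = (fine (mu core))%:E.
  by rewrite fineK// ge0_fin_numE// (le_lt_trans cS).
have vc : v = fine (mu core).
  apply/eqP; rewrite eq_le -[X in _ && X]lee_fin -cE -muE cS andbT.
  exact: le_mul_1Dharmonic le_mu_core.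
transitivity (mu simplex - mu core)%E; first by [].
by rewrite cE muE -EFinB vc subrr.
Qed.

(** Both coordinates are replaced by averages of [N] threshold indicators. The product is then at
    most [N^-2] times a double sum of indicators of corners, whose volumes are bounded by
    [corner_le]. [leq_sum2_exp] sums them up to the factor [(1 + 2 / N) ^+ d.+2], which tends to
    1. *)
Lemma integral_affine_fun2_le i j : (0 < d)%N -> i \in K -> j \in K -> i != j ->
  \int[mu]_(y in simplex) (lam j y * lam i y) <= v / (d.+1 * d.+2)%:R.
Proof.
move=> d0 iK jK ij.
have mS := measurable_simplex.
apply: (@le_mul_1Dharmonic _ _ _ 2 d.+2) => n.
pose N := n.+1.
pose A (p : 'I_N * 'I_N) : set 'rV[R]_d :=
  simplex `&` [set y | (p.1%:R / N%:R < lam i y)%R]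
          `&` [set y | (p.2%:R / N%:R < lam j y)%R].
have mA p : measurable (A p).
  apply: measurableI; last exact: measurable_affine_fun_gt.
  by apply: measurableI; [|exact: measurable_affine_fun_gt].
have muA p : (mu (A p) <= (((N - p.1 - p.2) ^ d)%N%:R / N%:R ^+ d * v)%:E)%E.
  (* If the thresholds add up to at least 1 the corner is empty, since the coordinates are
     nonnegative with sum 1. *)
  have [pN|pN] := leqP N (p.1 + p.2).
    rewrite (_ : A p = set0) ?measure0.
      by rewrite lee_fin mulr_ge0 ?divr_ge0 ?fine_ge0.
    rewrite -subset0 => y [[/= Sy yi] yj].
    have := sum_affine_fun y; rewrite (bigD1 i)//= (bigD1 j)/= 1?eq_sym ?jK//.
    have : 0 <= \sum_(k in K | (k != i) && (k != j)) lam k y.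
      by apply: sumr_ge0 => k /andP[kK _]; exact: Sy.
    under [X in 0 <= X]eq_bigl do rewrite andbA.
    have : 1 <= p.1%:R / N%:R + p.2%:R / N%:R :> R.
      by rewrite -mulrDl -natrD ler_pdivlMr// mul1r ler_nat.
    move: yi yj; lra.
  have E : 1 - p.1%:R / N%:R - p.2%:R / N%:R = (N - p.1 - p.2)%N%:R / N%:R :> R.
    rewrite -subnDA natrB; last exact: ltnW.
    by rewrite natrD; field; rewrite /N pnatr_eq0.
  rewrite natrX -expr_div_n -E EFinM -muE; apply: corner_le => //.
  by rewrite E divr_gt0// ltr0n -subnDA subn_gt0.
pose F y : R := \sum_p \1_(A p) y.
have mF p : measurable_fun simplex (fun y => \1_(A p) y : R).
  exact: measurable_indic.
have lamF y : simplex y -> lam j y * lam i y <= N%:R^-1 ^+ 2 * F y.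
  move=> Sy.
  have li := @le_avg_lt_nat R _ n (affine_fun_le1 iK Sy).
  have lj := @le_avg_lt_nat R _ n (affine_fun_le1 jK Sy).
  have := ler_pM (Sy i iK) (Sy j jK) li lj.
  rewrite mulrC => /le_trans; apply.
  rewrite mulrACA -expr2 ler_wpM2l ?exprn_ge0//.
  rewrite big_distrlr/= pair_big/= ler_sum// => p _.
  rewrite indicE -natrM ler_nat mulnb /A.
  case: andP => [[h1 h2]|//].
  by rewrite mem_set.
have mlam k : measurable_fun simplex (lam k).
  by apply: measurable_funTS; exact: measurable_affine_fun.
have F0 y : 0 <= F y by rewrite sumr_ge0.
have mFS : measurable_fun simplex F by exact: measurable_sum.
have intF : (\int[mu]_(y in simplex) (F y)%:E =
    \sum_(p : 'I_N * 'I_N) mu (A p))%E.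
  under eq_integral => y _ do rewrite -sumEFin.
  rewrite ge0_integral_sum//; last first.
  - by move=> p; exact/measurable_EFinP.
  apply: eq_bigr => p _; rewrite integral_indic//; congr (mu _).
  by apply: setIidl => y [[]].
have le1 : (\int[mu]_(y in simplex) (lam j y * lam i y)%:E <=
    (N%:R^-1 ^+ 2)%:E * \sum_(p : 'I_N * 'I_N) mu (A p))%E.
  have mEF : measurable_fun simplex (EFin \o F) by exact/measurable_EFinP.
  have N20 : (0 <= (N%:R^-1 ^+ 2 : R)%:E)%E by rewrite lee_fin exprn_ge0.
  rewrite -intF -ge0_integralZl// => [|y _]; last by rewrite lee_fin.
  apply: ge0_le_integral => //.
  - by move=> y Sy; rewrite lee_fin mulr_ge0 ?Sy.
  - by apply/measurable_EFinP; exact: measurable_funM.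
  - by apply/measurable_EFinP; apply: measurable_funM.
have le2 : ((N%:R^-1 ^+ 2)%:E * \sum_(p : 'I_N * 'I_N) mu (A p) <=
    (v / (d.+1 * d.+2)%:R * (1 + 2 / N%:R) ^+ d.+2)%:E)%E.
  apply: (@le_trans _ _ ((N%:R^-1 ^+ 2)%:E * \sum_(p : 'I_N * 'I_N)
      (((N - p.1 - p.2) ^ d)%N%:R / N%:R ^+ d * v)%:E)%E).
    by rewrite lee_wpmul2l ?lee_fin ?exprn_ge0// lee_sum.
  rewrite sumEFin -EFinM lee_fin -mulr_suml -mulr_suml -natr_sum.
  rewrite -(pair_bigA _ (fun k l : 'I_N => ((N - k - l) ^ d)%N))/=.
  have := leq_sum2_exp N N d0; set T := (\sum_(k < N) _)%N => hT.
  have v0 : 0 <= v by exact: fine_ge0.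
  have N0 : 0 < N%:R :> R by rewrite ltr0n.
  have -> : 1 + 2 / N%:R = N.+2%:R / N%:R :> R.
    by rewrite -addn2 natrD; field; rewrite gt_eqF.
  rewrite expr_div_n [leRHS](_ : _ =
    v / N%:R ^+ d.+2 * (N.+2%:R ^+ d.+2 / (d.+1 * d.+2)%:R)); last by ring.
  rewrite [leLHS](_ : _ = v / N%:R ^+ d.+2 * T%:R); last first.
    rewrite -[d.+2]addn2 exprD; field.
    by rewrite gt_eqF ?expf_neq0 ?gt_eqF.
  rewrite ler_wpM2l ?divr_ge0 ?exprn_ge0 ?(ltW N0)//.
  rewrite ler_pdivlMr ?ltr0n// -natrX -natrM ler_nat mulnC//.
have I0 : (0 <= \int[mu]_(y in simplex) (lam j y * lam i y)%:E)%E.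
  by apply: integral_ge0 => y Sy; rewrite lee_fin mulr_ge0 ?Sy.
rewrite /Rintegral -lee_fin fineK ?(le_trans le1)//.
by rewrite ge0_fin_numE// (le_lt_trans (le_trans le1 le2))// ltry.
Qed.

End simplex.

(** * The mesh and the scheme *)

Section mesh_geometry.
Context (R : realType) (d : nat) (Omega : set 'rV[R]_d) (Th : mesh R d).
Variable phi : 'I_(Nv Th) -> 'rV[R]_d -> R.
Variables (a : {set 'I_(Nv Th)} -> 'I_(Nv Th) -> 'cV[R]_d).
Variables (b : {set 'I_(Nv Th)} -> 'I_(Nv Th) -> R).
Hypothesis triTh : triangulation Omega Th.
Hypothesis phi_vertex : forall j i, phi j (vertex Th i) = (i == j)%:R.
Hypothesis phiE : forall K j x, K \in elements Th -> hull K x ->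
  phi j x = affine_fun (a K) (b K) j x.

Local Notation lam K := (affine_fun (a K) (b K)).
Local Notation simplex K := (simplex K (a K) (b K)).
Local Notation core K := (core K (a K) (b K)).
Local Notation mu := (lebesgue_rV R d).

(** * Basis functions as barycentric coordinates of the elements *)

Lemma card_element K : K \in elements Th -> #|K| = d.+1.
Proof. by case: triTh => h _ _ _ _ /h[]. Qed.

Lemma hull_vertex (K : {set 'I_(Nv Th)}) i : i \in K -> hull K (vertex Th i).
Proof.
move=> iK; exists (fun j => (j == i)%:R); split => [j|j jK||].
- by rewrite ler0n.
- by case: eqP => // ji; rewrite ji iK in jK.
- by rewrite (bigD1 i)//= eqxx big1 ?addr0// => j /negbTE ->.
- rewrite (bigD1 i)//= eqxx scale1r big1 ?addr0// => j /negbTE ->.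
  by rewrite scale0r.
Qed.

Lemma affine_fun_vertex K : K \in elements Th ->
  forall i j, i \in K -> j \in K -> lam K i (vertex Th j) = (j == i)%:R.
Proof.
move=> KT i j _ jK.
by rewrite -phiE//; exact: hull_vertex.
Qed.

(** On [K] the function [phi i] is affine, and at the vertices it is 0 or 1, so it returns the
    coefficient of vertex [i]. This also covers [i] outside [K], where the coefficient is 0. *)
Lemma phi_hull (K : {set 'I_(Nv Th)}) (c : 'I_(Nv Th) -> R) i :
  K \in elements Th ->
  (forall j, 0 <= c j) -> (forall j, j \notin K -> c j = 0) -> \sum_j c j = 1 ->
  phi i (\sum_j c j *: vertex Th j) = c i.
Proof.
move=> KT c0 cK c1; rewrite (phiE _ KT); last by exists c.
rewrite /affine_fun mulmx_suml summxE -[b K i]mul1r -c1 mulr_suml -big_split/=.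
rewrite (bigD1 i)//= big1 ?addr0 => [|j ji]; last first.
  have [jK|/cK ->] := boolP (j \in K); last first.
    by rewrite scale0r mul0mx mxE mul0r addr0.
  rewrite -scalemxAl mxE -mulrDr.
  rewrite [X in c j * X](_ : _ = phi i (vertex Th j)); last first.
    by rewrite (phiE _ KT)//; exact: hull_vertex.
  by rewrite phi_vertex (negbTE ji) mulr0.
have [iK|/cK ->] := boolP (i \in K); last first.
  by rewrite scale0r mul0mx mxE mul0r addr0.
rewrite -scalemxAl mxE -mulrDr.
rewrite [X in c i * X](_ : _ = phi i (vertex Th i)); last first.
  by rewrite (phiE _ KT)//; exact: hull_vertex.
by rewrite phi_vertex eqxx mulr1.
Qed.

Lemma phi_ge0_hull K i x : K \in elements Th -> hull K x -> 0 <= phi i x.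
Proof. by move=> KT [c [c0 cK c1 ->]]; rewrite (phi_hull _ KT). Qed.

Lemma phi_notin K i x : K \in elements Th -> hull K x -> i \notin K -> phi i x = 0.
Proof. by move=> KT [c [c0 cK c1 ->]] iK; rewrite (phi_hull _ KT)// cK. Qed.

Lemma sum_phi K x : K \in elements Th -> hull K x -> \sum_i phi i x = 1.
Proof.
move=> KT [c [c0 cK c1 ->]]; rewrite -[RHS]c1; apply: eq_bigr => i _.
by rewrite (phi_hull _ KT).
Qed.

Lemma phi_le1_hull K i x : K \in elements Th -> hull K x -> phi i x <= 1.
Proof.
move=> KT Kx; rewrite -(sum_phi KT Kx) (bigD1 i)//= lerDl.
by apply: sumr_ge0 => j _; exact: phi_ge0_hull Kx.
Qed.

(** The convex-combination and half-space descriptions agree: the coordinates [lam K i x] serve as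
    coefficients for [x]. *)
Lemma hullE K : K \in elements Th -> hull K = simplex K.
Proof.
move=> KT; apply/seteqP; split => x.
  by move=> Kx i iK; rewrite -(phiE _ KT)//; exact: phi_ge0_hull Kx.
move=> Sx; exists (fun i => if i \in K then lam K i x else 0); split.
- by move=> i; case: ifPn => // iK; exact: Sx.
- by move=> i /negbTE ->.
- rewrite -big_mkcond/=.
  exact: sum_affine_fun (card_element KT) (affine_fun_vertex KT) x.
- rewrite -{1}(affine_fun_bary (card_element KT) (affine_fun_vertex KT) x).
  rewrite big_mkcond/=; apply: eq_bigr => i _.
  by case: ifP => // _; rewrite scale0r.
Qed.

Lemma core_hull K x : K \in elements Th -> core K x -> hull K x.
Proof. by move=> KT Kx; rewrite hullE//; exact: sub_core. Qed.

(** This is where conformity enters: [x] lies in the hull of the common vertices. A vertex [i] of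
    [K] outside [L] would have coefficient 0 at [x], against [0 < lam K i x]. So [K] is included in
    [L], and the cardinals agree. *)
Lemma core_hull_eq K L x : K \in elements Th -> L \in elements Th ->
  core K x -> hull L x -> K = L.
Proof.
move=> KT LT Kx Lx; apply/eqP.
have KL : hull (K :&: L) x.
  case: triTh => _ /(_ K L KT LT) <- _ _ _; split => //; exact: core_hull.
rewrite eqEcard (card_element KT) (card_element LT) leqnn andbT.
apply/fintype.subsetP => i iK; apply/negPn/negP => iL.
case: KL => c [c0 cK c1 xE].
have /phi_notin : i \notin K :&: L by rewrite inE (negbTE iL) andbF.
have : 0 < phi i x by rewrite (phiE _ KT) ?Kx//; exact: core_hull.
rewrite xE (phi_hull _ KT)//.
  by rewrite cK ?ltxx// inE (negbTE iL) andbF.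
by move=> j jK; rewrite cK// inE (negbTE jK).
Qed.

Lemma closure_hull x : closure Omega x -> exists2 K, K \in elements Th & hull K x.
Proof. by case: triTh => _ _ -> _ _ [K KT Kx]; exists K. Qed.

Lemma hull_closure K x : K \in elements Th -> hull K x -> closure Omega x.
Proof. by move=> KT Kx; case: triTh => _ _ -> _ _; exists K. Qed.

Lemma phi_ge0 i x : closure Omega x -> 0 <= phi i x.
Proof. by move=> /closure_hull[K KT Kx]; exact: phi_ge0_hull Kx. Qed.

Lemma phi_le1 i x : closure Omega x -> phi i x <= 1.
Proof. by move=> /closure_hull[K KT Kx]; exact: phi_le1_hull Kx. Qed.

(** The affine function vanishes at the [d.+1] vertices of [K], hence on all of R^d by
    [affine_fun_bary]. [phiE] gives this only on the hull. *)
Lemma affine_fun_notin K i y : K \in elements Th -> i \notin K -> lam K i y = 0.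
Proof.
move=> KT iK.
have cK := card_element KT; have lK := affine_fun_vertex KT.
rewrite /affine_fun -{1}(affine_fun_bary cK lK y) mulmx_suml summxE.
rewrite -[X in _ + X]mul1r -[X in X * b K i](sum_affine_fun cK lK y).
rewrite mulr_suml -big_split/= big1// => j jK; rewrite -scalemxAl mxE -mulrDr.
rewrite -/(affine_fun (a K) (b K) i _) -(phiE _ KT) ?phi_vertex.
  by case: eqP => [ji|]; rewrite ?mulr0//; rewrite ji (negbTE iK) in jK.
exact: hull_vertex.
Qed.

Lemma gradient_notin K i : K \in elements Th -> i \notin K -> a K i = 0.
Proof.
move=> KT iK; apply/colP => l; rewrite mxE.
have /addIr : lam K i (delta_mx ord0 l) = lam K i 0 by rewrite !affine_fun_notin.
by rewrite -rowE mul0mx !mxE.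
Qed.

Lemma sum_gradient K : K \in elements Th -> \sum_i a K i = 0.
Proof.
move=> KT; rewrite -[RHS](sum_linear_fun (card_element KT) (affine_fun_vertex KT)).
rewrite [RHS]big_mkcond/=; apply: eq_bigr => i _.
by case: ifPn => // iK; rewrite gradient_notin.
Qed.

(** A small move from [x] along a coordinate direction keeps the finitely many strict inequalities
    of the core, so [phi i] stays affine and its difference quotients are constant. *)
Lemma grad_core K i x : K \in elements Th -> core K x -> grad (phi i) x = a K i.
Proof.
move=> KT Kx; apply/colP => k; rewrite mxE.
set v := delta_mx ord0 k.
have lamD h j : lam K j (h *: v + x) = h * a K j k ord0 + lam K j x.
  by rewrite /affine_fun mulmxDl -scalemxAl -rowE 3!mxE addrA.
have nK : \forall h \near (0 : R), core K (h *: v + x).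
  have : \forall h \near (0 : R), forall j : 'I_(Nv Th),
      j \in K -> 0 < h * a K j k ord0 + lam K j x.
    apply: (@filter_forall _ _ (fun (j : 'I_(Nv Th)) (h : R^o) =>
      j \in K -> 0 < h * a K j k ord0 + lam K j x) (nbhs (0 : R^o)) _) => j.
    have [jK|jK] := boolP (j \in K); last exact: nearW.
    have : (fun h : R => h * a K j k ord0 + lam K j x) @ (0 : R) --> lam K j x.
      rewrite -[X in _ --> X]add0r -[X in _ --> X + _](mul0r (a K j k ord0)).
      apply: cvgD; last exact: cvg_cst.
      by apply: cvgM; [exact: cvg_id|exact: cvg_cst].
    by move=> /cvgr_gt/(_ _ (Kx j jK)); apply: filterS => h h0 _.
  by apply: filterS => h H j jK; rewrite lamD H.
apply: cvg_lim => //; apply: cvg_near_cst.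
near=> h.
have h0 : h != 0 by near: h; exact: nbhs_dnbhs_neq.
have Kh : core K (h *: v + x) by near: h; exact: nbhs_dnbhs.
rewrite /= /shift/= (phiE _ KT (core_hull KT Kx)) (phiE _ KT (core_hull KT Kh)).
by rewrite lamD addrK scalerA mulVf// scale1r.
Unshelve. all: by end_near. Qed.

(** * Splitting integrals over the domain into elements *)

Hypothesis oOmega : open Omega.
Hypothesis vol_gt0 : forall K, K \in elements Th -> 0 < volume (hull K).

Let mOmega : measurable Omega. Proof. exact: open_measurable_rV. Qed.

(** [fine] sends [+oo] to 0, so a positive [volume] already means finite measure. *)
Lemma volume_element K : K \in elements Th -> mu (hull K) = (volume (hull K))%:E.
Proof.
move=> /vol_gt0; rewrite /volume; have := measure_ge0 mu (hull K).
by case: (mu (hull K)) => //=; rewrite ltxx.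
Qed.

Lemma lt_mu_simplex K : K \in elements Th -> (mu (simplex K) < +oo)%E.
Proof. by move=> KT; rewrite -hullE// volume_element// ltry. Qed.

Lemma element_null K : K \in elements Th -> mu (simplex K `\` core K) = 0%E.
Proof.
move=> KT.
exact: simplexD_core_null (card_element KT) (affine_fun_vertex KT) (lt_mu_simplex KT).
Qed.

(** The intersection with [Omega] is taken because [hull_closure] places the core only in the
    closure, while [D] is integrable on [Omega]. *)
Definition cell K := core K `&` Omega.

Lemma measurable_cell K : measurable (cell K).
Proof. by apply: measurableI => //; exact: measurable_core. Qed.

Lemma cell_closure K x : K \in elements Th -> cell K x -> closure Omega x.
Proof. by move=> KT [Kx _]; apply: (@hull_closure K) => //; exact: core_hull. Qed.

Lemma le_mu_cell K : K \in elements Th -> (mu (cell K) <= mu (simplex K))%E.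
Proof.
move=> KT; apply: le_measure; rewrite ?inE.
- exact: measurable_cell.
- exact: measurable_simplex.
- by move=> x [/sub_core].
Qed.

(** Union of the boundaries of the elements: off this null set the cells partition [Omega]. *)
Let skeleton := \bigcup_(K in [set` enum (elements Th)]) (simplex K `\` core K).

Let measurable_skeleton : measurable skeleton.
Proof.
apply: fin_bigcup_measurable => // K _; apply: measurableD.
  exact: measurable_simplex.
exact: measurable_core.
Qed.

Let mu_skeleton : mu skeleton = 0%E.
Proof.
rewrite /skeleton bigcup_seq; apply/negligibleP.
  rewrite -bigcup_seq; exact: measurable_skeleton.
rewrite big_seq; elim/big_ind : _ => [||K]; last rewrite mem_enum => KT.
- exact: negligible_set0.
- exact: negligibleU.
apply/negligibleP; last exact: element_null.
apply: measurableD; [exact: measurable_simplex|exact: measurable_core].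
Qed.

Lemma Rintegral_mesh (F : 'rV[R]_d -> R) :
  (forall K, K \in elements Th -> mu.-integrable (cell K) (EFin \o F)) ->
  \int[mu]_(x in Omega) F x = \sum_(K in elements Th) \int[mu]_(x in cell K) F x.
Proof.
move=> intF; rewrite /Rintegral.
(* [F] is known to be measurable only on the cells, so the skeleton is removed by a lemma that asks
   no measurability of the integrand. *)
rewrite (integral_setD_null _ _ measurable_skeleton mu_skeleton).
pose C K := if K \in elements Th then cell K else set0.
have -> : Omega `\` skeleton = \big[setU/set0]_(K <- enum (elements Th)) C K.
  rewrite -bigcup_seq; apply/seteqP; split => x.
    move=> [Ox Nx]; have [K KT Kx] := closure_hull (subset_closure Ox).
    exists K => /=; first by rewrite mem_enum.
    rewrite /C KT; split => //; apply: contrapT => nKx.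
    by apply: Nx; exists K; rewrite /= ?mem_enum//; split => //; rewrite -hullE.
  move=> [K /=]; rewrite mem_enum => KT; rewrite /C KT => -[Kx Ox]; split => //.
  move=> [L /=]; rewrite mem_enum => LT [Lx nLx].
  have KL : K = L by apply: core_hull_eq Kx _ => //; rewrite hullE.
  by apply: nLx; rewrite -KL.
have mC K : measurable (C K).
  by rewrite /C; case: ifP => // _; exact: measurable_cell.
have tC : trivIset [set` enum (elements Th)] C.
  apply/trivIsetP => K L /=; rewrite !mem_enum => KT LT KL.
  rewrite /C KT LT -subset0 => x [[Kx _] [Lx _]]; move/eqP: KL; apply.
  by apply: core_hull_eq Kx _ => //; exact: core_hull.
rewrite integral_bigsetU_EFin//.
- rewrite big_enum/= -sum_fine.
    by apply: eq_bigr => K KT; rewrite /C KT.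
  move=> K KT; rewrite /C KT; apply: integrable_fin_num (intF _ KT).
  exact: measurable_cell.
- exact: enum_uniq.
rewrite big_seq; set S := (\big[_/_]_(_ <- _ | _) _).
suff [] : measurable S /\ measurable_fun S (EFin \o F) by [].
apply: (big_ind (fun A => measurable A /\ measurable_fun A (EFin \o F))).
- by split; [exact: measurable0|exact: measurable_fun_set0].
- by move=> A B [mA FA] [mB FB]; split; [exact: measurableU|exact/measurable_funU].
- move=> K; rewrite mem_enum => KT; split => //; rewrite /C KT.
  by have /integrableP[] := intF K KT.
Qed.

(** A class closed under sums and products, and integrable on cells because these have finite
    measure. It holds the basis functions and the reaction weights. *)
Definition bounded_measurable K (h : 'rV[R]_d -> R) :=
  measurable_fun (cell K) h /\ exists c, forall x, cell K x -> `|h x| <= c.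

Lemma bounded_measurable_integrable K h : K \in elements Th ->
  bounded_measurable K h -> mu.-integrable (cell K) (EFin \o h).
Proof.
move=> KT [mh [c hc]]; apply: measurable_bounded_integrable => //.
- exact: measurable_cell.
- by rewrite (le_lt_trans (le_mu_cell KT))// lt_mu_simplex.
exists c; split; first exact: num_real.
by move=> y cy x /hc hx; apply: le_trans hx _; exact: ltW.
Qed.

Lemma bounded_measurableM K h1 h2 : bounded_measurable K h1 ->
  bounded_measurable K h2 -> bounded_measurable K (fun x => h1 x * h2 x).
Proof.
move=> [m1 [c1 b1]] [m2 [c2 b2]]; split; first exact: measurable_funM.
by exists (c1 * c2) => x Kx; rewrite normrM ler_pM ?b1 ?b2.
Qed.

Lemma bounded_measurableD K h1 h2 : bounded_measurable K h1 ->
  bounded_measurable K h2 -> bounded_measurable K (fun x => h1 x + h2 x).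
Proof.
move=> [m1 [c1 b1]] [m2 [c2 b2]]; split; first exact: measurable_funD.
by exists (c1 + c2) => x Kx; rewrite (le_trans (ler_normD _ _))// lerD ?b1 ?b2.
Qed.

Lemma bounded_measurable_cst K c : bounded_measurable K (fun=> c).
Proof. by split; [exact: measurable_cst|exists `|c|]. Qed.

Lemma bounded_measurable_phi K i : K \in elements Th -> bounded_measurable K (phi i).
Proof.
move=> KT; split.
  apply: (@eq_measurable_fun _ _ _ _ _ (lam K i)).
    by move=> x; rewrite inE => -[Kx _]; rewrite (phiE _ KT (core_hull KT Kx)).
  by apply: measurable_funTS; exact: measurable_affine_fun.
exists 1 => x /(cell_closure KT) cx.
by rewrite ger0_norm ?phi_le1 ?phi_ge0.
Qed.

Lemma quadratic_formE (u v : 'cV[R]_d) (A : 'M[R]_d) :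
  (u^T *m A *m v) ord0 ord0 = \sum_l \sum_k u k ord0 * v l ord0 * A k l.
Proof.
rewrite mxE; apply: eq_bigr => l _; rewrite mxE mulr_suml; apply: eq_bigr => k _.
by rewrite mxE; ring.
Qed.

Variable D : 'rV[R]_d -> 'M[R]_d.
Hypothesis intD : forall k l, mu.-integrable Omega (fun x => (D x k l)%:E).

Lemma integrable_cell K k l : mu.-integrable (cell K) (fun x => (D x k l)%:E).
Proof.
by apply: (integrableS mOmega) => //; [exact: measurable_cell|move=> x []].
Qed.

(** The cell differs from [hull K] within [Omega] by a null set, and the positive volume cancels the
    inverse in [D_avg]. *)
Lemma Rintegral_cell_D_avg K k l : K \in elements Th ->
  \int[mu]_(x in cell K) D x k l = volume (hull K) * D_avg Omega D K k l.
Proof.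
move=> KT; rewrite mxE mulrA mulfV ?gt_eqF ?vol_gt0// mul1r /Rintegral.
have mN : measurable (simplex K `\` core K).
  by apply: measurableD; [exact: measurable_simplex|exact: measurable_core].
rewrite [in RHS](integral_setD_null _ _ mN (element_null KT)).
congr (fine (integral _ _ _)).
rewrite hullE//; apply/seteqP; split => x.
  by move=> [Kx Ox]; split; [split => //; exact: sub_core|case].
by move=> [[Sx Ox] nx]; split => //; apply: contrapT => Kx; exact: nx.
Qed.

(** The gradients are constant on the cell, so the integrand is a fixed linear combination of the
    entries of [D]. *)
Lemma stiffness_cell K i j : K \in elements Th ->
  mu.-integrable (cell K) (EFin \o (fun x =>
    ((grad (phi i) x)^T *m D x *m grad (phi j) x) ord0 ord0)) /\
  \int[mu]_(x in cell K) ((grad (phi i) x)^T *m D x *m grad (phi j) x) ord0 ord0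
  = volume (hull K) * ((a K i)^T *m D_avg Omega D K *m a K j) ord0 ord0.
Proof.
move=> KT.
pose c k l := a K i k ord0 * a K j l ord0.
have E x : cell K x -> ((grad (phi i) x)^T *m D x *m grad (phi j) x) ord0 ord0 =
    \sum_l \sum_k c k l * D x k l.
  by move=> [Kx _]; rewrite !(grad_core _ KT Kx) quadratic_formE.
have mK := measurable_cell K.
have int1 k l : mu.-integrable (cell K) (EFin \o (fun x => c k l * D x k l)).
  exact: (integrableZl mK (c k l) (integrable_cell K k l)).
have int2 l : mu.-integrable (cell K)
    (EFin \o (fun x => \sum_k c k l * D x k l)).
  apply: eq_integrable (integrable_sum mK (index_enum _) (P := xpredT)
    (fun k _ => int1 k l)) => // x _ /=.
  by rewrite sumEFin.
have int3 : mu.-integrable (cell K)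
    (EFin \o (fun x => \sum_l \sum_k c k l * D x k l)).
  apply: eq_integrable (integrable_sum mK (index_enum _) (P := xpredT)
    (fun l _ => int2 l)) => // x _ /=.
  by rewrite sumEFin.
split.
  by apply: eq_integrable int3 => // x; rewrite inE => Kx /=; rewrite E.
transitivity (\int[mu]_(x in cell K) \sum_l \sum_k c k l * D x k l).
  by apply: eq_Rintegral => x; rewrite inE; exact: E.
rewrite Rintegral_sum// quadratic_formE mulr_sumr; apply: eq_bigr => l _.
rewrite Rintegral_sum// mulr_sumr; apply: eq_bigr => k _.
rewrite RintegralZl//; last exact: integrable_cell.
by rewrite Rintegral_cell_D_avg// /c; ring.
Qed.

(** * Bounds for the mass integrals on one element *)

Hypothesis d0 : (0 < d)%N.

Lemma mass_cell_le K i j : K \in elements Th -> i \in K -> j \in K -> i != j ->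
  \int[mu]_(x in cell K) (phi j x * phi i x) <=
  volume (hull K) / (d.+1 * d.+2)%:R.
Proof.
move=> KT iK jK ij.
have cK := card_element KT; have lK := affine_fun_vertex KT.
have mS := @measurable_simplex R d _ K (a K) (b K).
have := integral_affine_fun2_le cK lK (lt_mu_simplex KT) d0 iK jK ij.
rewrite -hullE// -/(volume (hull K)); apply: le_trans.
rewrite hullE//.
have int : mu.-integrable (simplex K) (EFin \o (fun y => lam K j y * lam K i y)).
  apply: measurable_bounded_integrable => //; first exact: lt_mu_simplex.
    by apply: measurable_funM; apply: measurable_funTS; exact: measurable_affine_fun.
  exists 1; split; first exact: num_real.
  move=> y y1 x Sx; rewrite /= ger0_norm ?mulr_ge0 ?Sx//.
  by rewrite (le_trans _ (ltW y1))// mulr_ile1 ?Sx// (affine_fun_le1 cK lK).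
rewrite [leLHS](_ : _ = \int[mu]_(x in cell K) (lam K j x * lam K i x)); last first.
  apply: eq_Rintegral => x; rewrite inE => -[Kx _].
  by rewrite !(phiE _ KT (core_hull KT Kx)).
have CS : cell K `<=` simplex K by move=> x [/sub_core].
have mC := measurable_cell K.
rewrite /Rintegral fine_le//.
- by apply: integrable_fin_num => //; exact: integrableS int.
- exact: integrable_fin_num int.
apply: ge0_subset_integral => //.
- by have /integrableP[] := int.
- by move=> x Sx; rewrite lee_fin mulr_ge0 ?Sx.
Qed.

(** The core is shrunk towards the vertex until it fits in a ball inside [Omega]. On this copy,
    which has positive measure, [phi i] is at least 1/2. *)
Lemma phi_cell_gt0 K i : K \in elements Th -> i \in K -> Omega (vertex Th i) ->
  0 < \int[mu]_(x in cell K) phi i x.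
Proof.
move=> KT iK Oi; set p := vertex Th i in Oi *.
have cK := card_element KT; have lK := affine_fun_vertex KT.
have /nbhs_ballP[e /= e0 eO] := open_nbhs_nbhs (conj oOmega Oi).
pose C := \sum_(k in K) `|vertex Th k - p|.
have C0 : 0 <= C by rewrite sumr_ge0.
have core_le x : core K x -> `|x - p| <= C.
  move=> Kx; rewrite -{1}(affine_fun_bary cK lK x) -{1}[p]scale1r.
  rewrite -(sum_affine_fun cK lK x) scaler_suml -sumrB.
  rewrite (le_trans (ler_norm_sum _ _ _))//.
  apply: ler_sum => k kK; rewrite -scalerBr normrZ (ger0_norm (ltW (Kx k kK))).
  by rewrite ler_piMl// (affine_fun_le1 cK lK)//; exact: sub_core.
(* The first bound gives [phi i >= 1 - r >= 1 / 2]. The second gives [r * C < e], where [C] bounds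
   the distance from [p] to points of the core, and [C + 1] keeps the divisor positive. *)
pose r := Num.min (1 / 2) (e / (C + 1) / 2).
have r0 : 0 < r by rewrite lt_min !divr_gt0//; lra.
have r1 : r <= 1 / 2 by rewrite ge_min lexx.
have re : r * C < e.
  have : r <= e / (C + 1) / 2 by rewrite ge_min lexx orbT.
  have C1 : 0 < C + 1 by lra.
  rewrite mulrAC ler_pdivlMr//.
  move=> h; nra.
(* [g] inverts the homothety of centre [p] and ratio [r], so [S] is the shrunken copy of the
   core. *)
pose q := - ((1 - r) / r) *: p.
pose g (z : 'rV[R]_d) := q + r^-1 *: z.
pose S := g @^-1` core K.
have gE z : z = (1 - r) *: p + 0 *: p + r *: g z.
  rewrite /g /q scale0r addr0 scalerDr !scalerA mulfV ?gt_eqF// scale1r mulrN.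
  by rewrite mulrCA mulfV ?gt_eqF// mulr1 scaleNr addrA subrr add0r.
have mS : measurable S.
  rewrite -[X in measurable X]setTI; apply: measurable_homothety => //.
  exact: measurable_core.
have SC : S `<=` cell K.
  move=> z Sz; split.
    move=> k kK; rewrite (gE z) affine_fun_comb; last by ring.
    rewrite mul0r addr0 ltr_wpDl ?mulr_gt0 ?Sz// mulr_ge0 ?lK ?ler0n//; lra.
  apply: eO; rewrite -ball_normE/= distrC.
  have -> : z - p = r *: (g z - p).
    by rewrite {1}(gE z); move: (g z) => y; apply/rowP => k; rewrite !mxE; ring.
  rewrite normrZ gtr0_norm// (le_lt_trans _ re)// ler_pM2l//; exact: core_le.
have S12 z : S z -> 1 / 2 <= phi i z.
  move=> Sz; have [Kz _] := SC _ Sz; rewrite (phiE _ KT (core_hull KT Kz)).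
  rewrite {1}(gE z) affine_fun_comb; last by ring.
  rewrite lK// eqxx mul0r addr0 mulr1 ler_wpDr//; last lra.
  by rewrite mulr_ge0 ?(ltW r0) ?(ltW (Sz _ iK)).
have muS0 : (0 < mu S)%E.
  rewrite /S lebesgue_rV_homothety ?invr_gt0//; last exact: measurable_core.
  rewrite mule_gt0// ?lte_fin ?exprn_gt0 ?invrK//.
  have : (mu (simplex K) - mu (core K) = 0)%E.
    rewrite -(element_null KT) measureD ?(setIidr (@sub_core _ _ _ K (a K) (b K)))//.
    - exact: measurable_simplex.
    - exact: measurable_core.
    - exact: lt_mu_simplex.
  rewrite -hullE// volume_element//.
  have := measure_ge0 mu (core K); rewrite le_eqVlt => /orP[/eqP <-|//].
  by rewrite sube0 => -[] V0; have := vol_gt0 KT; rewrite V0 ltxx.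
have intC := bounded_measurable_integrable KT (bounded_measurable_phi i KT).
have mC := measurable_cell K.
rewrite /Rintegral fine_gt0//; apply/andP; split; last first.
  have := integrable_fin_num mC intC; rewrite ge0_fin_numE//.
  by apply: integral_ge0 => x /(cell_closure KT) cx; rewrite lee_fin phi_ge0.
apply: (@lt_le_trans _ _ (\int[mu]_(x in S) (1 / 2 : R)%:E)%E).
  by rewrite integral_cst// mule_gt0// lte_fin.
apply: (@le_trans _ _ (\int[mu]_(x in S) (phi i x)%:E)%E).
  apply: ge0_le_integral => //.
  by apply: (measurable_funS mC SC); have /integrableP[] := intC.
apply: ge0_subset_integral => //.
- by have /integrableP[] := intC.
- by move=> x /(cell_closure KT) cx; rewrite lee_fin phi_ge0.
Qed.

(** * Signs of the entries and row sums for a given weight *)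

Section step.
Variables (w : 'rV[R]_d -> R) (tau : R).
Hypothesis bw : forall K, K \in elements Th -> bounded_measurable K w.
Hypothesis tau0 : 0 <= tau.

Let bounded_phi2 K i j : K \in elements Th ->
  bounded_measurable K (fun x => phi j x * phi i x).
Proof. by move=> KT; apply: bounded_measurableM; exact: bounded_measurable_phi. Qed.

Let bounded_wphi2 K i j : K \in elements Th ->
  bounded_measurable K (fun x => w x * phi j x * phi i x).
Proof.
move=> KT; apply: bounded_measurableM; last exact: bounded_measurable_phi.
by apply: bounded_measurableM; [exact: bw|exact: bounded_measurable_phi].
Qed.

Definition cell_entry K i j :=
  \int[mu]_(x in cell K) (phi j x * phi i x)
  - tau * \int[mu]_(x in cell K) (w x * phi j x * phi i x)
  + tau * (volume (hull K) *
      ((a K i)^T *m D_avg Omega D K *m a K j) ord0 ord0).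

Lemma system_entryE i j :
  \int[mu]_(x in Omega) (phi j x * phi i x)
  - tau * \int[mu]_(x in Omega) (w x * phi j x * phi i x)
  + tau * \int[mu]_(x in Omega)
      ((grad (phi i) x)^T *m D x *m grad (phi j) x) ord0 ord0
  = \sum_(K in elements Th) cell_entry K i j.
Proof.
rewrite Rintegral_mesh => [|K KT]; last first.
  by apply: bounded_measurable_integrable => //; exact: bounded_phi2.
rewrite Rintegral_mesh => [|K KT]; last first.
  by apply: bounded_measurable_integrable => //; exact: bounded_wphi2.
rewrite Rintegral_mesh => [|K KT]; last by have [] := stiffness_cell i j KT.
rewrite !mulr_sumr -sumrB -big_split/=; apply: eq_bigr => K KT.
by have [_ ->] := stiffness_cell i j KT.
Qed.

(** With both vertices in [K], the mass terms are at most [(1 + tau * m)] times the bound of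
    [mass_cell_le], and the stiffness term is at most [- tau * volume (hull K) * alpha], which
    outweighs it. Otherwise the entry is 0. *)
Lemma cell_entry_le0 K i j (m alpha : R) : K \in elements Th -> i != j ->
  0 <= m -> (forall x, Omega x -> - m <= w x) ->
  1 + tau * m <= tau * ((d.+1 * d.+2)%:R * alpha) ->
  (i \in K -> j \in K ->
    alpha <= - ((a K i)^T *m D_avg Omega D K *m a K j) ord0 ord0) ->
  cell_entry K i j <= 0.
Proof.
move=> KT ij m0 mw tm al; rewrite /cell_entry.
have mK := measurable_cell K.
have i1 := bounded_measurable_integrable KT (bounded_phi2 i j KT).
have i2 := bounded_measurable_integrable KT (bounded_wphi2 i j KT).
have [/andP[iK jK]|notK] := boolP ((i \in K) && (j \in K)); last first.
  have z x : cell K x -> phi j x * phi i x = 0.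
    move=> [/(core_hull KT) Kx _].
    move: notK; rewrite negb_and => /orP[]/(phi_notin KT Kx) ->.
      by rewrite mulr0.
    by rewrite mul0r.
  rewrite (@eq_Rintegral _ _ _ _ _ (fun=> 0)); last by move=> x; rewrite inE => /z.
  rewrite (@eq_Rintegral _ _ _ _ _ (fun=> 0) (fun x => w x * _ * _)); last first.
    by move=> x; rewrite inE -mulrA => /z ->; rewrite mulr0.
  rewrite Rintegral_cst// mul0r mulr0 subr0 add0r.
  move: notK; rewrite negb_and => /orP[]/(gradient_notin KT) ->.
    by rewrite trmx0 !mul0mx mxE !mulr0.
  by rewrite mulmx0 mxE !mulr0.
have {}al := al iK jK.
rewrite -RintegralZl// -RintegralB//; last exact: (integrableZl mK tau i2).
set V := volume (hull K); set q := (_ *m _ *m _) _ _ in al *.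
have V0 : 0 < V by exact: vol_gt0.
apply: (@le_trans _ _ ((1 + tau * m) * (V / (d.+1 * d.+2)%:R) + tau * (V * q))).
  rewrite lerD2r.
  apply: (@le_trans _ _ ((1 + tau * m) *
      \int[mu]_(x in cell K) (phi j x * phi i x))); last first.
    by rewrite ler_wpM2l ?addr_ge0 ?mulr_ge0// mass_cell_le.
  rewrite -RintegralZl//; apply: le_Rintegral => //.
  - apply: (bounded_measurable_integrable KT).
    apply: bounded_measurableD; first exact: bounded_phi2.
    rewrite (_ : (fun x => _) = fun x => - tau * (w x * phi j x * phi i x)).
      apply: bounded_measurableM; first exact: bounded_measurable_cst.
      exact: bounded_wphi2.
    by apply/funext => x; rewrite mulNr.
  - exact: (integrableZl mK (1 + tau * m) i1).
  move=> x Kx; have cx := cell_closure KT Kx.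
  have p0 : 0 <= phi j x * phi i x by rewrite mulr_ge0 ?phi_ge0.
  have wm : 0 <= w x + m by rewrite -lerBlDr sub0r mw//; case: Kx.
  (* This product is the difference of the two integrands being compared. *)
  have := mulr_ge0 (mulr_ge0 tau0 p0) wm.
  by rewrite -(mulrA (w x)); set p := phi j x * phi i x; lra.
have n0 : 0 < (d.+1 * d.+2)%:R :> R by rewrite ltr0n.
set n := (_ * _)%:R in tm n0 *.
rewrite [leLHS](_ : _ = V * ((1 + tau * m) / n + tau * q)); last by ring.
rewrite pmulr_rle0// -lerBrDr sub0r ler_pdivrMr//.
apply: (le_trans tm); rewrite -mulrN -mulrA ler_wpM2l// mulrC ler_pM2r//.
Qed.

(** The basis functions sum to 1 and their gradients to 0. The row sum is thus the integral of
    [(1 - tau * w) * phi i]. *)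
Lemma sum_cell_entry_ge K i (M : R) : K \in elements Th ->
  (forall x, Omega x -> w x <= M) ->
  (1 - tau * M) * \int[mu]_(x in cell K) phi i x <= \sum_j cell_entry K i j.
Proof.
move=> KT wM; rewrite !big_split/= -!mulr_sumr.
have mK := measurable_cell K.
have ip := bounded_measurable_integrable KT (bounded_measurable_phi i KT).
have -> : \sum_j ((a K i)^T *m D_avg Omega D K *m a K j) ord0 ord0 = 0.
  by rewrite -summxE -mulmx_sumr sum_gradient// mulmx0 mxE.
rewrite !mulr0 addr0 sumrN -mulr_sumr.
rewrite -Rintegral_sum// => [|j]; last first.
  by apply: bounded_measurable_integrable => //; exact: bounded_phi2.
rewrite -Rintegral_sum// => [|j]; last first.
  by apply: bounded_measurable_integrable => //; exact: bounded_wphi2.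
have sp x : cell K x -> \sum_j phi j x = 1.
  by move=> [Kx _]; exact: (sum_phi KT (core_hull KT Kx)).
rewrite (@eq_Rintegral _ _ _ _ _ (phi i)); last first.
  by move=> x; rewrite inE => Kx; rewrite -mulr_suml sp// mul1r.
rewrite [X in _ <= _ - tau * X](_ : _ =
    \int[mu]_(x in cell K) (w x * phi i x)); last first.
  apply: eq_Rintegral => x; rewrite inE => Kx.
  by rewrite -mulr_suml -mulr_sumr sp// mulr1.
rewrite mulrBl mul1r lerD2l lerN2 -mulrA ler_wpM2l// -RintegralZl//.
apply: le_Rintegral => //.
- apply: (bounded_measurable_integrable KT).
  by apply: bounded_measurableM; [exact: bw|exact: bounded_measurable_phi].
- exact: (integrableZl mK M ip).
by move=> x Kx; rewrite ler_wpM2r ?wM//; [apply/phi_ge0/(cell_closure KT)|case: Kx].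
Qed.

Lemma mass_rhs_ge0 i j (M : R) :
  (forall x, Omega x -> w x <= M) -> tau * M <= 1 ->
  0 <= \int[mu]_(x in Omega) (phi j x * phi i x)
     - tau * \int[mu]_(x in Omega) (w x * phi j x * phi i x).
Proof.
move=> wM tM.
rewrite Rintegral_mesh => [|K KT]; last first.
  by apply: bounded_measurable_integrable => //; exact: bounded_phi2.
rewrite Rintegral_mesh => [|K KT]; last first.
  by apply: bounded_measurable_integrable => //; exact: bounded_wphi2.
rewrite mulr_sumr -sumrB sumr_ge0// => K KT.
have mK := measurable_cell K.
have i1 := bounded_measurable_integrable KT (bounded_phi2 i j KT).
have i2 := bounded_measurable_integrable KT (bounded_wphi2 i j KT).
rewrite subr_ge0 -RintegralZl//; apply: le_Rintegral => //.
  exact: (integrableZl mK tau i2).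
move=> x Kx; have cx := cell_closure KT Kx.
have p0 : 0 <= phi j x * phi i x by rewrite mulr_ge0 ?phi_ge0.
have wm : 0 <= M - w x by rewrite subr_ge0 wM//; case: Kx.
have tM0 : 0 <= 1 - tau * M by rewrite subr_ge0.
(* The two products add up to [p - tau * w x * p], where [p] is [phi j x * phi i x]. *)
have := mulr_ge0 (mulr_ge0 tau0 p0) wm; have := mulr_ge0 p0 tM0.
by rewrite -(mulrA (w x)); set p := phi j x * phi i x; lra.
Qed.

End step.

(** * Reaction weights, mesh quantities and one time step *)

Variable f : R -> R.
Hypothesis rf : reaction_term f.
Hypothesis Omega0 : Omega !=set0.

(** Since every [phi j] lies between 0 and 1, [uh] is bounded by the sum of the [|v j|], and the
    hypothesis on [f] applies. Hence the suprema in [max_neg] and [max_pos] are over bounded sets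
    and are genuine upper bounds. *)
Lemma weight_bound (v : 'cV[R]_(Nv Th)) :
  exists c : R, forall x, closure Omega x ->
  `|uh_df phi f v x| <= c /\ `|f_uh_df phi f v x| <= c.
Proof.
case: rf => _ _ _ /(_ (\sum_j `|v j ord0|))[c hc].
set B := \sum_j _ in hc.
exists (c + B * c) => x cx.
have uB : `|uh phi v x| <= B.
  rewrite /uh (le_trans (ler_norm_sum _ _ _))//; apply: ler_sum => j _.
  by rewrite normrM (ger0_norm (phi_ge0 j cx)) ler_piMr ?phi_le1.
have [fc f'c] := hc _ uB.
have ufc : `|uh_df phi f v x| <= B * c by rewrite /uh_df normrM ler_pM.
split; first by rewrite (le_trans ufc)// lerDr (le_trans _ fc).
by rewrite /f_uh_df (le_trans (ler_normD _ _))// lerD.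
Qed.

Lemma bounded_measurable_weight K (v : 'cV[R]_(Nv Th)) : K \in elements Th ->
  bounded_measurable K (uh_df phi f v) /\ bounded_measurable K (f_uh_df phi f v).
Proof.
move=> KT; have [c hc] := weight_bound v.
have muh : measurable_fun (cell K) (uh phi v).
  apply: measurable_sum => j; apply: measurable_funM => //.
  by have [] := bounded_measurable_phi j KT.
case: rf => cf _ cf' _.
have mf : measurable_fun (cell K) (f \o uh phi v).
  exact: measurableT_comp (continuous_measurable_fun cf) muh.
have mf' : measurable_fun (cell K) (derive1 f \o uh phi v).
  exact: measurableT_comp (continuous_measurable_fun cf') muh.
have m1 : measurable_fun (cell K) (uh_df phi f v) by exact: measurable_funM.
split; split => //.
- by exists c => x /(cell_closure KT)/hc[].
- exact: measurable_funD.
- by exists c => x /(cell_closure KT)/hc[].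
Qed.

Lemma max_overP (h : 'rV[R]_d -> R) (c : R) x :
  (forall y, closure Omega y -> h y <= c) -> closure Omega x ->
  h x <= max_over (closure Omega) h.
Proof.
move=> hc cx; apply: sup_upper_bound; last by exists x.
split; first by exists (h x), x.
by exists c => _ [y cy <-]; exact: hc.
Qed.

Lemma max_negP (v : 'cV[R]_(Nv Th)) x : closure Omega x ->
  `|Num.min (f_uh_df phi f v x) 0| <= max_neg Omega phi f v.
Proof.
move=> cx; have [c hc] := weight_bound v.
apply: (@max_overP (fun y => `|Num.min (f_uh_df phi f v y) 0|) c) => // y /hc[_ h].
rewrite (le_trans _ h)//; rewrite minEle; case: ifP => // _.
by rewrite normr0.
Qed.

Lemma max_neg_ge0 (v : 'cV[R]_(Nv Th)) : 0 <= max_neg Omega phi f v.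
Proof.
case: Omega0 => x /subset_closure cx.
by rewrite (le_trans _ (max_negP v cx)).
Qed.

Lemma f_uh_df_ge (v : 'cV[R]_(Nv Th)) x : Omega x ->
  - max_neg Omega phi f v <= f_uh_df phi f v x.
Proof.
move=> /subset_closure cx; have := max_negP v cx.
rewrite ler_norml => /andP[h _]; rewrite (le_trans h)//.
by rewrite ge_min lexx.
Qed.

Lemma max_posP (v : 'cV[R]_(Nv Th)) x : closure Omega x ->
  Num.max (Num.max (uh_df phi f v x) 0) (Num.max (f_uh_df phi f v x) 0)
  <= max_pos Omega phi f v.
Proof.
move=> cx; have [c hc] := weight_bound v.
apply: (@max_overP (fun y => Num.max (Num.max (uh_df phi f v y) 0)
  (Num.max (f_uh_df phi f v y) 0)) c) => // y /hc[h1 h2].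
rewrite !ge_max (le_trans (ler_norm _) h1) (le_trans (ler_norm _) h2).
by rewrite (le_trans _ h1).
Qed.

Lemma max_pos_ge0 (v : 'cV[R]_(Nv Th)) : 0 <= max_pos Omega phi f v.
Proof.
case: Omega0 => x /subset_closure cx.
by rewrite (le_trans _ (max_posP v cx))// !le_max lexx !orbT.
Qed.

Lemma uh_df_le (v : 'cV[R]_(Nv Th)) x : Omega x ->
  uh_df phi f v x <= max_pos Omega phi f v.
Proof.
by move=> /subset_closure/(max_posP v); apply: le_trans; rewrite !le_max lexx.
Qed.

Lemma f_uh_df_le (v : 'cV[R]_(Nv Th)) x : Omega x ->
  f_uh_df phi f v x <= max_pos Omega phi f v.
Proof.
by move=> /subset_closure/(max_posP v); apply: le_trans; rewrite !le_max lexx !orbT.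
Qed.

Lemma mesh_scale_ge0 : 0 <= mesh_scale Omega Th.
Proof. exact: powR_ge0. Qed.

Lemma D_acute_le K i j : K \in elements Th -> i \in K -> j \in K -> i != j ->
  D_acute Omega phi D <= mesh_scale Omega Th *
    - ((a K i)^T *m D_avg Omega D K *m a K j) ord0 ord0.
Proof.
move=> KT iK jK ij; rewrite ler_wpM2l ?mesh_scale_ge0//.
pose val (p : {set 'I_(Nv Th)} * 'I_(Nv Th) * 'I_(Nv Th)) :=
  ((grad_on phi p.1.1 p.1.2)^T *m D_avg Omega D p.1.1 *m
    grad_on phi p.1.1 p.2) ord0 ord0.
apply: ge_inf; last first.
  exists K, i, j; split => //; rewrite /grad_on !(@grad_core K)//.
  - exact: core_barycenter (card_element KT) (affine_fun_vertex KT).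
  - exact: core_barycenter (card_element KT) (affine_fun_vertex KT).
(* The infimum is a lower bound only for a set bounded below. Minus the sum of the absolute values
   over all triples is such a bound. *)
exists (- \sum_p `|val p|) => _ [L [k [l [_ _ _ _ ->]]]].
rewrite lerN2 -/(val (L, k, l)) (bigD1 (L, k, l))//=.
by rewrite (le_trans (ler_norm _))// lerDl sumr_ge0.
Qed.

(** If the volume were 0, its inverse would be 0 by convention, so [D_avg] and the entry for two
    distinct vertices of [K] would vanish and [D_acute] would be at most 0. This supplies [vol_gt0]
    in the theorem. *)
Lemma D_acute_volume : 0 < D_acute Omega phi D ->
  forall K, K \in elements Th -> 0 < volume (hull K).
Proof.
move=> D0 K KT; rewrite lt_neqAle fine_ge0// andbT eq_sym; apply/eqP => V0.
have /card_gt1P[i [j [iK jK ij]]] : (1 < #|K|)%N by rewrite card_element.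
have := D_acute_le KT iK jK ij.
rewrite leNgt => /negP; apply; apply: le_lt_trans D0.
have -> : D_avg Omega D K = 0.
  by apply/matrixP => k l; rewrite !mxE V0 invr0 mul0r.
by rewrite mulmx0 mul0mx mxE oppr0 mulr0.
Qed.

Lemma D_acute_gt0 (v : 'cV[R]_(Nv Th)) (n : nat) :
  mesh_scale Omega Th * (max_neg Omega phi f v / n%:R) < D_acute Omega phi D ->
  0 < D_acute Omega phi D.
Proof.
by apply: le_lt_trans; rewrite mulr_ge0 ?mesh_scale_ge0// divr_ge0 ?max_neg_ge0.
Qed.

Lemma interior_vertex (i : 'I_(Nv Th)) : (i < Nvi Th)%N -> Omega (vertex Th i).
Proof.
case: triTh => _ _ _ /(_ i)[K KT iK] [_ /(_ i)[h _]] /h nb.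
have cx := hull_closure KT (hull_vertex iK).
by apply: interior_subset; apply: contrapT => nint; apply: nb.
Qed.

Lemma scheme_step_ge0 (tau t : R) (g : 'rV[R]_d -> R -> R)
    (v v' : 'cV[R]_(Nv Th)) :
  0 < tau -> (forall j, 0 <= v j ord0) ->
  (forall i, boundary Omega (vertex Th i) -> 0 <= g (vertex Th i) t) ->
  (mass_mx Omega phi - tau *: B_mx Omega phi f v
     + tau *: stiffness_mx Omega phi D) *m v' =
  (mass_mx Omega phi + tau *: C_mx Omega phi f v) *m v
    + tau *: boundary_vec Th g t ->
  mesh_scale Omega Th * (max_neg Omega phi f v / (d.+1 * d.+2)%:R)
    < D_acute Omega phi D ->
  mesh_scale Omega Th / ((d.+1 * d.+2)%:R * D_acute Omega phi D
     - mesh_scale Omega Th * max_neg Omega phi f v) <= tau ->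
  (tau%:E < 1 / (max_pos Omega phi f v)%:E)%E ->
  forall j, 0 <= v' j ord0.
Proof.
move=> tau0 v0 g0 scheme hmesh hlow hup.
set m := max_neg _ _ _ _ in hmesh hlow; set s := mesh_scale _ _ in hmesh hlow.
set A := D_acute _ _ _ in hmesh hlow; set M := max_pos _ _ _ _ in hup.
have m0 : 0 <= m by exact: max_neg_ge0.
have s0 : 0 <= s by exact: mesh_scale_ge0.
have n0 : 0 < (d.+1 * d.+2)%:R :> R by rewrite ltr0n.
have A0 : 0 < A := D_acute_gt0 hmesh.
have sgt0 : 0 < s.
  rewrite lt_neqAle s0 andbT; apply/eqP => s00.
  by move: A0; rewrite /A /D_acute -/s -s00 mul0r ltxx.
(* When [M = 0] the extended-real bound is [+oo] and the claim is immediate. *)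
have tM : tau * M < 1.
  have : 0 <= M by exact: max_pos_ge0.
  rewrite le_eqVlt => /predU1P[<-|M0]; first by rewrite mulr0.
  move: hup; rewrite mul1e inver gt_eqF// lte_fin => h.
  by rewrite -ltr_pdivlMr// div1r.
have den : 0 < (d.+1 * d.+2)%:R * A - s * m.
  rewrite subr_gt0; move: hmesh; rewrite mulrA ltr_pdivrMr// => h.
  by rewrite [ltRHS]mulrC.
(* The lower bound on the time step, cleared of its denominator and divided by the mesh scale.
   [A / s] is then the bound [alpha] of [cell_entry_le0]. *)
have key : 1 + tau * m <= tau * ((d.+1 * d.+2)%:R * (A / s)).
  move: hlow; rewrite ler_pdivrMr// => h.
  rewrite -(ler_pM2l sgt0); apply: le_trans
    (_ : _ <= tau * ((d.+1 * d.+2)%:R * A)) _.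
    by move: h; lra.
  by rewrite le_eqVlt; apply/orP; left; apply/eqP; field; rewrite gt_eqF.
have bw K (KT : K \in elements Th) := (bounded_measurable_weight v KT).2.
have bw' K (KT : K \in elements Th) := (bounded_measurable_weight v KT).1.
set L := (X in X *m v') in scheme.
have LE (i j : 'I_(Nv Th)) : (i < Nvi Th)%N ->
    L i j = \sum_(K in elements Th) cell_entry (f_uh_df phi f v) tau K i j.
  by move=> iI; rewrite -system_entryE// !mxE iI.
apply: (@mmatrix_ge0 _ _ L v' (fun i : 'I_(Nv Th) => i < Nvi Th)%N).
(* A boundary row reads [tau * v' i = tau * g], so the new value is the boundary datum. *)
- move=> i iB.
  have bi : boundary Omega (vertex Th i).
    apply: contrapT => nb; move/negP: iB; apply.
    by case: triTh => _ _ _ _ [_ h]; apply/h.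
  have := congr1 (fun V : 'cV_(Nv Th) => V i ord0) scheme => /=.
  rewrite !mxE (negbTE iB) (bigD1 i)//= !mxE (negbTE iB) eqxx.
  rewrite mulr0 subr0 add0r mulr1 big1 => [|j ji]; last first.
    by rewrite !mxE (negbTE iB) eq_sym (negbTE ji) !mulr0 subr0 addr0 mul0r.
  rewrite big1 => [|j _]; last by rewrite !mxE (negbTE iB) oppr0 mulr0 addr0 mul0r.
  by rewrite addr0 add0r => /(mulfI (lt0r_neq0 tau0)) ->; exact: g0.
- move=> i j iI ij; rewrite LE//; apply: sumr_le0 => K KT.
  apply: (@cell_entry_le0 _ _ _ _ _ _ _ m (A / s)) => //.
  + exact: ltW.
  + by move=> x; exact: f_uh_df_ge.
  + by move=> iK jK; rewrite ler_pdivrMr// mulrC; exact: D_acute_le.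
- move=> i iI; under eq_bigr do rewrite LE//.
  rewrite exchange_big/=.
  have le1 K : K \in elements Th ->
      (1 - tau * M) * \int[mu]_(x in cell K) phi i x
      <= \sum_j cell_entry (f_uh_df phi f v) tau K i j.
    move=> KT; apply: sum_cell_entry_ge => //; first exact: ltW.
    by move=> x; exact: f_uh_df_le.
  (* Every element contributes a nonnegative integral of [phi i], and one that has [i] as a vertex
     contributes a positive one. *)
  apply: (lt_le_trans _ (ler_sum _ le1)); rewrite -mulr_sumr mulr_gt0 ?subr_gt0//.
  case: triTh => _ _ _ /(_ i)[K KT iK] _.
  rewrite (bigD1 K)//= ltr_wpDr//.
    apply: sumr_ge0 => Q /andP[QT _]; apply: Rintegral_ge0 => x Qx.
    exact/phi_ge0/(cell_closure QT).
  by apply: phi_cell_gt0 => //; exact: interior_vertex.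
- move=> i iI; rewrite scheme !mxE iI mulr0 addr0; apply: sumr_ge0 => j _.
  rewrite mulr_ge0// !mxE iI mulrN.
  apply: (@mass_rhs_ge0 _ _ bw' (ltW tau0) i j M _ (ltW tM)) => x.
  exact: uh_df_le.
Qed.

Lemma uh_ge0 (v : 'cV[R]_(Nv Th)) x : (forall j, 0 <= v j ord0) ->
  Omega x -> 0 <= uh phi v x.
Proof.
move=> v0 /subset_closure cx; apply: sumr_ge0 => j _.
by rewrite mulr_ge0 ?phi_ge0.
Qed.

End mesh_geometry.

(** * Induction over the time levels *)

Unset Implicit Arguments.

Theorem theorem3p2 (R : realType) (d : nat) (hd : (1 <= d <= 3)%N)
  (Omega : set 'rV[R]_d) (hOmega : polyhedral_domain Omega)
  (T : R) (hT : 0 < T)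
  (D : 'rV[R]_d -> 'M[R]_d) (hD : diffusion_tensor Omega D)
  (f : R -> R) (hf : reaction_term f)
  (u0 : 'rV[R]_d -> R) (g : 'rV[R]_d -> R -> R)
  (Th : mesh R d) (hTh : triangulation Omega Th)
  (phi : 'I_(Nv Th) -> 'rV[R]_d -> R) (hphi : nodal_basis Omega phi)
  (N : nat) (t : nat -> R) (ht0 : t 0%N = 0)
  (htS : forall n, (n < N)%N -> t n < t n.+1) (htN : t N <= T)
  (u : nat -> 'cV[R]_(Nv Th))
  (hu0_ge0 : forall x, (Omega `|` range (vertex Th)) x -> 0 <= u0 x)
  (hg_ge0 : forall x s, boundary Omega x -> 0 < s <= T -> 0 <= g x s)
  (hu_init : u 0%N = \col_j u0 (vertex Th j))
  (hscheme : forall n, (n < N)%N ->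
    (mass_mx Omega phi - (t n.+1 - t n) *: B_mx Omega phi f (u n)
       + (t n.+1 - t n) *: stiffness_mx Omega phi D) *m u n.+1
    = (mass_mx Omega phi + (t n.+1 - t n) *: C_mx Omega phi f (u n)) *m u n
       + (t n.+1 - t n) *: boundary_vec Th g (t n.+1))
  (hmesh : forall n, (n < N)%N ->
    mesh_scale Omega Th * (max_neg Omega phi f (u n) / ((d + 1) * (d + 2))%:R)
    < D_acute Omega phi D)
  (hdt_lower : forall n, (n < N)%N ->
    mesh_scale Omega Th
      / (((d + 1) * (d + 2))%:R * D_acute Omega phi D
          - mesh_scale Omega Th * max_neg Omega phi f (u n))
    <= t n.+1 - t n)
  (* extended-real division: 1 / 0 = +oo *)
  (hdt_upper : forall n, (n < N)%N ->
    ((t n.+1 - t n)%:E < 1 / (max_pos Omega phi f (u n))%:E)%E) :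
  (forall n j, (n <= N)%N -> 0 <= u n j ord0) /\
  (forall n x, (n <= N)%N -> Omega x -> 0 <= uh phi (u n) x).
Proof.
have d0 : (0 < d)%N by case/andP: hd.
have [ne0 oOmega _ _ _] := hOmega.
have [_ intD _ _] := hD.
(* Affine coefficients are chosen for all pairs of a vertex set and an index at once, with the dummy
   [(0, 0)] when the set is not an element. *)
have /choice[ab abE] : forall p : {set 'I_(Nv Th)} * 'I_(Nv Th),
    exists ab : 'cV[R]_d * R, p.1 \in elements Th ->
      forall x, hull p.1 x -> phi p.2 x = (x *m ab.1) ord0 ord0 + ab.2.
  move=> p; have [pT|pT] := boolP (p.1 \in elements Th); last by exists (0, 0).
  by have [_ /(_ _ pT)[a [b ab]] _] := hphi p.2; exists (a, b).
pose a K i := (ab (K, i)).1; pose b K i := (ab (K, i)).2.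
have phiE K j x : K \in elements Th -> hull K x ->
    phi j x = affine_fun (a K) (b K) j x.
  by move=> KT; exact: (abE (K, j) KT).
have phiV j i : phi j (vertex Th i) = (i == j)%:R by have [_ _ ->] := hphi j.
have u_ge0 n j : (n <= N)%N -> 0 <= u n j ord0.
  elim: n j => [|n IH] j nN.
    by rewrite hu_init mxE hu0_ge0//; right; exists j.
  (* Monotonicity of the time levels places [t n.+1] in the interval from 0 (excluded) to [T], where
     [g] is nonnegative. *)
  have tmono k : (k <= N)%N -> 0 <= t k.
    elim: k => [|k IHk] kN; first by rewrite ht0.
    by rewrite (le_trans (IHk (ltnW kN)))// ltW// htS.
  have tle k : (n.+1 + k <= N)%N -> t n.+1 <= t (n.+1 + k)%N.
    elim: k => [|k IHk]; first by rewrite addn0.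
    by rewrite addnS => kN; rewrite (le_trans (IHk (ltnW kN)))// ltW// htS.
  have hm := hmesh n nN; have hl := hdt_lower n nN.
  rewrite addn1 addn2 in hm hl.
  (* Positivity of [D_acute], and with it of the volumes, comes from the mesh condition at level
     [n], hence inside the inductive step. *)
  have A0 := D_acute_gt0 hTh phiV phiE hf ne0 hm.
  apply: (scheme_step_ge0 hTh phiV phiE oOmega _ intD d0 hf ne0 _ _ _
    (hscheme n nN) hm hl (hdt_upper n nN)).
  - exact: (D_acute_volume hTh phiV phiE _ A0).
  - by rewrite subr_gt0 htS.
  - by move=> k; apply: IH; exact: ltnW.
  - move=> i bi; apply: hg_ge0 => //.
    rewrite (le_lt_trans (tmono n (ltnW nN)) (htS n nN))/= (le_trans _ htN)//.
    by have := tle (N - n.+1)%N; rewrite subnKC//; apply.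
split=> // n x nN; apply: (uh_ge0 hTh phiV phiE) => j; exact: u_ge0.
Qed.
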